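(* For every real $r\ge 1$, the Fuss-Catalan distribution $\mu(2r,r)$ is unimodal.
   Context: Fuss-Catalan distributions: for real $p,r$ put $A_0(p,r)=1$ and $A_k(p,r)=\frac{r}{k!}\prod_{i=1}^{k-1}(kp+r-i)$ for $k\ge 1$. For $p\ge 1$, $0<r\le p$, it is known that there is a unique compactly supported Borel probability measure $\mu(p,r)$ on $\mathbb{R}$ with $\int x^k\,\mu(p,r)(dx)=A_k(p,r)$ for all $k\ge 0$. It is the Fuss-Catalan distribution. A measure $\rho$ on $\mathbb{R}$ is unimodal if there are $a\in\mathbb{R}$ (the mode), $c\ge 0$ and a function $f\ge 0$, non-decreasing on $(-\infty,a)$ and non-increasing on $(a,\infty)$, with $\rho(dx)=c\,\delta_a(dx)+f(x)\,dx$. *)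

(* Defs.v *)
From HB Require Import structures.
From mathcomp Require Import all_boot all_order all_algebra.
From mathcomp Require Import all_classical all_reals all_analysis.

Set Implicit Arguments.
Unset Strict Implicit.
Unset Printing Implicit Defensive.

Import Order.TTheory GRing.Theory Num.Theory.
Import numFieldNormedType.Exports.

Local Open Scope classical_set_scope.
Local Open Scope ring_scope.

Definition fuss_catalan_number {R : realType} (p r : R) (k : nat) : R :=
  if k is 0 then 1
  else r / k`!%:R * \prod_(1 <= i < k) (k%:R * p + r - i%:R).

Definition compactly_supported {R : realType}
    (mu : {measure set (measurableTypeR R) -> \bar R}) : Prop :=
  exists2 K : set R, compact K & mu (~` K) = 0%E.

(* [mu] is the Fuss-Catalan distribution mu(p, r). A compactly supported
   probability measure is determined by its moments, and for 1 <= p and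
   0 < r <= p one with these moments exists. *)
Definition is_fuss_catalan {R : realType} (p r : R)
    (mu : probability (measurableTypeR R) R) : Prop :=
  compactly_supported mu /\
  forall k : nat,
    (\int[mu]_x (x ^+ k)%:E)%E = (fuss_catalan_number p r k)%:E.

(* The value f a is irrelevant, as {a} is a Lebesgue-null set; in particular a
   density that is unbounded near a is allowed. Measurability of f follows from
   the two monotonicity conditions. *)
Definition unimodal {R : realType}
    (rho : {measure set (measurableTypeR R) -> \bar R}) : Prop :=
  exists (a c : R) (f : R -> R),
    [/\ 0 <= c,
        forall x, 0 <= f x,
        {in `]-oo, a[ &, {homo f : x y / x <= y}},
        {in `]a, +oo[ &, {homo f : x y / x <= y >-> y <= x}} &
        forall A : set (measurableTypeR R), measurable A ->
          rho A =
            (c%:E * \d_a A + \int[lebesgue_measure]_(x in A) (f x)%:E)%E].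

(* Main.v *)
(** Put [p = 2 r], [n = 2 k + 1]. The k-th moment of mu(p, r) is
    [C(r n, k) / n], and [C(al, k)] is the integral of
    [(1 + w) ^ al * w ^ (- k) * dw / (2 i pi w)] along a closed curve around 0.
    On the curve [w = sin x / sin ((p - 1) x) * e^(i p x)], [|x| < pi / p], the
    function [(1 + w) ^ p / w] takes positive real values [rho x], so that
    [C(r n, k)] is the integral of [rho ^ (k + 1 / 2)] against a weight in [x]
    that does not depend on [k] and turns out to be nonnegative. Dividing by
    [n / 2] amounts to replacing [rho x ^ (k + 1 / 2)] by the k-th moment of the
    density [y ^ (- 1 / 2)] on [0 < y < rho x]; a mixture of such densities is
    nonincreasing on [y > 0]. Finally, compactly supported measures with equal
    moments coincide.

    The contour integral is evaluated without Cauchy's theorem. Integrating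
    the derivative of [(1 + w) ^ al * w ^ (- k)] reduces it to [k = 0], and to
    the value [1] at natural [al]. A polynomial iteration of Visser
    approximates square roots on the disk [|1 - z| <= 1], which contains
    [1 + w] and its powers [(1 + w) ^ (1 / 2 ^ m)]; this gives dyadic [al], and
    real [al] follows by continuity. *)
Require Import Defs.
From HB Require Import structures.
From mathcomp Require Import all_boot all_order all_algebra.
From mathcomp Require Import all_classical all_reals all_analysis.
From mathcomp Require Import measurable_realfun complex.
From mathcomp Require Import ring lra.

Set Implicit Arguments.
Unset Strict Implicit.
Unset Printing Implicit Defensive.

Import Order.TTheory GRing.Theory Num.Theory.
Import numFieldNormedType.Exports.

Local Open Scope classical_set_scope.
Local Open Scope ring_scope.

(** * Determinacy of the moment problem *)

Section density_measure.
Context {d : measure_display} {T : measurableType d} {R : realType}.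
Variables (m : {measure set T -> \bar R}) (g : T -> R).
Hypotheses (mg : measurable_fun setT g) (g0 : forall x, 0 <= g x).

(** The two proofs are arguments so that the measure structure declared below can be inferred from
    the term itself. *)
Definition density_measure (_ : measurable_fun setT g)
  (_ : forall x, 0 <= g x) (A : set T) : \bar R := (\int[m]_(x in A) (g x)%:E)%E.

Let mu := density_measure mg g0.

Let mu0 : mu set0 = 0%E. Proof. exact: integral_set0. Qed.

Let mu_ge0 A : (0 <= mu A)%E.
Proof. by apply: integral_ge0 => x _; rewrite lee_fin. Qed.

Let mu_additive : semi_sigma_additive mu.
Proof.
apply: semi_sigma_additive_nng_induced; first exact/measurable_EFinP.
by move=> x; rewrite lee_fin.
Qed.

HB.instance Definition _ := isMeasure.Build _ _ _ mu mu0 mu_ge0 mu_additive.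

Definition density : {measure set T -> \bar R} := mu.

End density_measure.

Section step_polynomials.
Context {R : realType}.
Implicit Types (c u y : R) (n m : nat).

Lemma exprBn_ge y m : 0 <= y <= 1 -> 1 - m%:R * y <= (1 - y) ^+ m.
Proof.
move=> /andP[y0 y1]; elim: m => [|m IH]; first by rewrite expr0 mul0r subr0.
rewrite exprSr; apply: (@le_trans _ _ ((1 - m%:R * y) * (1 - y))).
  have : 0 <= m%:R * y ^+ 2 by rewrite mulr_ge0// sqr_ge0.
  by rewrite -natr1; lra.
by rewrite ler_wpM2r// subr_ge0.
Qed.

(** The counterpart of Bernoulli's inequality for large [m * y]; the induction rests on
    [(1 - y) * (1 + (m + 1) * y) <= 1 + m * y]. *)
Lemma exprBn_le y m : 0 <= y <= 1 -> (1 - y) ^+ m * (1 + m%:R * y) <= 1.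
Proof.
move=> /andP[y0 y1]; elim: m => [|m IH]; first by rewrite expr0 mul0r addr0 mulr1.
rewrite exprSr; apply: le_trans IH.
rewrite -mulrA ler_wpM2l ?exprn_ge0 ?subr_ge0//.
have : 0 <= (m%:R + 1) * y ^+ 2 by rewrite mulr_ge0// ?sqr_ge0// addr_ge0.
by rewrite -natr1; lra.
Qed.

(* With this exponent [m], [m * u ^ n.*2] tends to [0] if [c * u <= 1] and to
   infinity if [c * u > 1], so that even the boundary case has limit [1]. *)
Definition step_exponent c n : nat := Num.truncn (c ^+ (n.*2) / n%:R).

(** With [m] the exponent and [y = u ^+ n.*2], the number [(c * u) ^+ n.*2 / n] lies between [m * y]
    and [m * y + 1]; the two bounds on [(1 - y) ^+ m] then settle the two cases. *)
Lemma cvg_step c u : 0 < c -> 0 <= u <= 1 ->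
  (1 - u ^+ (n.*2)) ^+ step_exponent c n @[n --> \oo] -->
  (if c * u <= 1 then 1 else 0 : R).
Proof.
(* The shift discards [n = 0], where [step_exponent] divides by zero. *)
move=> c0 /andP[u0 u1]; rewrite -cvg_shiftS/=.
have un n : 0 <= u ^+ n <= 1 by rewrite exprn_ge0//= exprn_ile1.
have hle n : (step_exponent c n.+1)%:R * u ^+ (n.+1.*2) <= (c * u) ^+ n.+1.*2 / n.+1%:R.
  rewrite exprMn mulrAC ler_wpM2r//; first by case/andP: (un n.+1.*2).
  by rewrite truncn_le divr_ge0// exprn_ge0// ltW.
have hge n : (c * u) ^+ n.+1.*2 / n.+1%:R <=
    1 + (step_exponent c n.+1)%:R * u ^+ (n.+1.*2).
  rewrite exprMn mulrAC.
  have /andP[_ /ltW h] : (step_exponent c n.+1)%:R <= c ^+ n.+1.*2 / n.+1%:R < (step_exponent c n.+1).+1%:R.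
    by apply: truncn_itv; rewrite divr_ge0// exprn_ge0// ltW.
  have /andP[y0 y1] := un n.+1.*2.
  apply: (@le_trans _ _ ((step_exponent c n.+1).+1%:R * u ^+ (n.+1.*2))).
    exact: ler_wpM2r.
  by rewrite -natr1 mulrDl mul1r addrC lerD2r.
have Q0 n : 0 <= (1 - u ^+ n.+1.*2) ^+ step_exponent c n.+1.
  by rewrite exprn_ge0// subr_ge0; case/andP: (un n.+1.*2).
case: ifPn => [cu1|]; last rewrite -ltNge => cu1.
  apply: (@squeeze_cvgr _ _ _ _ (fun n => 1 - harmonic n) (cst 1)).
  - near=> n; apply/andP; split; last first.
      by rewrite exprn_ile1// ?subr_ge0 ?gerBl; case/andP: (un n.+1.*2).
    apply: le_trans (exprBn_ge _ (un _)).
    rewrite lerD2l lerN2; apply: le_trans (hle _) _.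
    rewrite ler_piMl// ?invr_ge0//.
    by rewrite exprn_ile1// mulr_ge0// ltW.
  - rewrite -[X in _ --> X]subr0; apply: cvgB; first exact: cvg_cst.
    exact: cvg_harmonic.
  - exact: cvg_cst.
pose h := c * u - 1.
have h0 : 0 < h by rewrite subr_gt0.
apply: (@squeeze_cvgr _ _ _ _ (cst 0) (fun n => (h ^+ 2)^-1 * harmonic n)).
- near=> n; apply/andP; split; first exact: Q0.
  (* With [N = n.+1], Bernoulli for [c * u = 1 + h] gives [(c * u) ^+ N >= N * h], and the square of
     this beats the division by [N]. *)
  have hn : n.+1%:R * h ^+ 2 <= (c * u) ^+ n.+1.*2 / n.+1%:R.
    rewrite ler_pdivlMr// -muln2 exprM.
    have -> : n.+1%:R * h ^+ 2 * n.+1%:R = (n.+1%:R * h) ^+ 2 :> R by ring.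
    rewrite ler_sqr ?nnegrE; first last.
    - by rewrite exprn_ge0// mulr_ge0// ltW.
    - by rewrite mulr_ge0// ltW.
    have -> : c * u = 1 + h by rewrite /h; ring.
    elim: (n.+1) => [|k IH]; first by rewrite mul0r.
    have : 1 <= (1 + h) ^+ k by rewrite exprn_ege1// lerDl ltW.
    by rewrite exprS -natr1; nra.
  have := exprBn_le (step_exponent c n.+1) (un n.+1.*2).
  have := le_trans hn (hge n).
  move: (Q0 n); set x := (1 - _) ^+ _; set y := 1 + _ * _ => x0 ny xy.
  rewrite /= /harmonic/= -invfM -div1r ler_pdivlMr; last by rewrite mulr_gt0// exprn_gt0.
  apply: le_trans xy; rewrite ler_wpM2l// mulrC//.
- exact: cvg_cst.
- rewrite -[X in _ --> X](mulr0 (h ^+ 2)^-1); apply: cvgMr.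
  exact: cvg_harmonic.
Unshelve. all: by end_near.
Qed.

End step_polynomials.

Lemma dominated_cvg_Rintegral {d : measure_display} {T : measurableType d}
    {R : realType} (mu : {measure set T -> \bar R}) (D : set T)
    (f_ : (T -> R)^nat) (f g : T -> R) :
  measurable D -> (forall n, measurable_fun D (f_ n)) ->
  (forall x, D x -> f_ ^~ x @ \oo --> f x) ->
  mu.-integrable D (EFin \o g) ->
  (forall n x, D x -> `|f_ n x| <= g x) ->
  \int[mu]_(x in D) f_ n x @[n --> \oo] --> \int[mu]_(x in D) f x.
Proof.
move=> mD mf_ f_f ig f_g.
have mf : measurable_fun D f by exact: (measurable_fun_cvg _ f_f).
have [] := @dominated_convergence _ T R mu D mD
    (fun n => EFin \o f_ n) (EFin \o f) (EFin \o g) _ _ _ ig _.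
- by move=> n; exact/measurable_EFinP.
- exact/measurable_EFinP.
- by apply: aeW => x Dx; apply/cvg_EFin; [exact: nearW|exact: f_f].
- by apply: aeW => x n Dx; rewrite lee_fin f_g.
move=> i1 _ h.
apply: fine_cvg; rewrite fineK//.
exact: integrable_fin_num.
Qed.

Lemma Rintegral_sum {d : measure_display} {T : measurableType d} {R : realType}
    (mu : {measure set T -> \bar R}) (D : set T) (I : Type) (s : seq I)
    (f : I -> T -> R) :
  measurable D -> (forall i, mu.-integrable D (EFin \o f i)) ->
  \int[mu]_(x in D) (\sum_(i <- s) f i x) = \sum_(i <- s) \int[mu]_(x in D) f i x.
Proof.
move=> mD fi; elim: s => [|i s IH].
  rewrite big_nil; under eq_Rintegral do rewrite big_nil.
  by rewrite Rintegral_cst// mul0r.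
rewrite big_cons -IH -RintegralD//.
  by apply: eq_Rintegral => x _; rewrite big_cons.
rewrite (_ : EFin \o _ = (fun x => \sum_(i <- s) (EFin \o f i) x)%E).
  exact: integrable_sum.
by apply/funext => x/=; rewrite sumEFin.
Qed.

Section determinacy.
Context {R : realType}.
Local Notation mR := (measurableTypeR R).

Section moments.
Variables (m : {measure set mR -> \bar R}) (g : mR -> R) (M : R).
Hypotheses (M0 : 0 < M) (g0 : forall x, 0 <= g x).
Hypothesis supp_g : forall x, ~~ (- M < x < M) -> g x = 0.
Hypothesis ig : m.-integrable setT (EFin \o g).

Let mg : measurable_fun setT g.
Proof. by case/integrableP : ig => /measurable_EFinP. Qed.

Lemma horner_bounded (P : {poly R}) x : - M < x < M ->
  `|P.[x]| <= \sum_(i < size P) `|P`_i| * M ^+ i.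
Proof.
move=> xM; rewrite horner_coef; apply: le_trans (ler_norm_sum _ _ _) _.
apply: ler_sum => i _; rewrite normrM normrX ler_wpM2l// lerXn2r ?nnegrE// ?(ltW M0)//.
by rewrite ler_norml; case/andP: xM => /ltW -> /ltW ->.
Qed.

Lemma integrable_polyM (P : {poly R}) :
  m.-integrable setT (EFin \o (fun x => P.[x] * g x)).
Proof.
pose K := \sum_(i < size P) `|P`_i| * M ^+ i.
apply: (@le_integrable _ _ _ m setT _ _ (fun x => K%:E * (EFin \o g) x)%E) => //.
- apply/measurable_EFinP/measurable_funM => //.
  apply: continuous_measurable_fun; exact: continuous_horner.
- move=> x _ /=; rewrite lee_fin !normrM.
  have [xM|/supp_g ->] := boolP (- M < x < M); last by rewrite normr0 !mulr0.
  by rewrite ler_wpM2r// (le_trans (horner_bounded _ xM))// ler_norm.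
- exact: integrableZl.
Qed.

Lemma Rintegral_polyM (P : {poly R}) :
  \int[m]_x (P.[x] * g x) = \sum_(i < size P) P`_i * \int[m]_x (x ^+ i * g x).
Proof.
have iX i : m.-integrable setT (EFin \o (fun x => x ^+ i * g x)).
  by have := integrable_polyM 'X^i; under eq_fun do rewrite /= hornerXn.
under eq_bigr do rewrite -RintegralZl//.
rewrite -Rintegral_sum//; last first.
  move=> i; rewrite (_ : EFin \o _ = fun x => ((P`_i)%:E * (x ^+ i * g x)%:E)%E)//.
  exact: (integrableZl _ _ (iX i)).
apply: eq_Rintegral => x _; rewrite horner_coef mulr_suml.
by apply: eq_bigr => i _; rewrite mulrA.
Qed.

(** The affine map sends [[- M, M]] to [[0, 1]] and [t] to the reciprocal of the first argument of
    [step_exponent]. For [- M < t] these polynomials thus tend to the indicator of []t, +oo[] on []-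
    M, M[]. *)
Definition step_poly t n : {poly R} :=
  1 - (1 - ((2 * M)^-1 *: ('X + M%:P)) ^+ (n.*2)) ^+ step_exponent (2 * M / (t + M)) n.

(** Where [g] is nonzero the polynomials take values in [[0, 1]], so [g] itself dominates. *)
Lemma cvg_Rintegral_step_poly t : - M < t ->
  \int[m]_x ((step_poly t n).[x] * g x) @[n --> \oo] -->
  \int[m]_(x in `]t, +oo[) g x.
Proof.
move=> Mt; rewrite Rintegral_mkcond.
pose u x := (2 * M)^-1 * (x + M).
have Q x n : (step_poly t n).[x] =
    1 - (1 - u x ^+ (n.*2)) ^+ step_exponent (2 * M / (t + M)) n.
  by rewrite /step_poly !hornerE.
have u01 x : - M < x < M -> 0 <= u x <= 1.
  move=> /andP[x1 x2]; rewrite /u mulrC ler_pdivrMr ?ler_pdivlMr ?mulr_gt0//.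
  by apply/andP; split; lra.
apply: (@dominated_cvg_Rintegral _ _ _ m setT _ _ g) => //.
- move=> n; apply: measurable_funM => //.
  by apply: continuous_measurable_fun; exact: continuous_horner.
- move=> x _; rewrite patchE.
  have [xM|xM] := boolP (- M < x < M); last first.
    rewrite (supp_g xM) if_same.
    by under eq_fun do rewrite mulr0; exact: cvg_cst.
  have := @cvg_step R (2 * M / (t + M)) (u x).
  have tM : 0 < t + M by lra.
  rewrite divr_gt0 ?mulr_gt0// => /(_ erefl (u01 _ xM)).
  have -> : 2 * M / (t + M) * u x = (x + M) / (t + M).
    by rewrite /u; field; rewrite !gt_eqF.
  rewrite ler_pdivrMr// mul1r lerD2r => h.
  have -> : (if x \in `]t, +oo[%classic then g x else 0) =
      (1 - (if x <= t then 1 else 0)) * g x.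
    rewrite mem_setE in_itv/= andbT ltNge.
    by case: (x <= t); rewrite /= ?subrr ?mul0r ?subr0 ?mul1r.
  under eq_fun do rewrite Q.
  by apply: cvgMl; apply: cvgB => //; exact: cvg_cst.
- move=> n x _; rewrite normrM (ger0_norm (g0 x)).
  have [xM|/supp_g ->] := boolP (- M < x < M); last by rewrite mulr0.
  rewrite ler_piMl// Q; have /andP[u0 u1] := u01 _ xM.
  have /andP[v0 v1] : 0 <= (1 - u x ^+ n.*2) ^+ step_exponent (2 * M / (t + M)) n <= 1.
    have := exprn_ile1 n.*2 u0 u1; have := exprn_ge0 n.*2 u0 => w0 w1.
    by rewrite exprn_ge0 ?subr_ge0//= exprn_ile1 ?subr_ge0// gerBl.
  by rewrite ger0_norm; lra.
Qed.

End moments.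

(** Moments determine integrals of polynomials, hence through step polynomials the masses of rays,
    and rays form a generating pi-system. Two base measures are allowed because one side will be an
    arbitrary probability cut off by an indicator and the other a Lebesgue density. *)
Lemma eq_density_moments (m1 m2 : {measure set mR -> \bar R})
    (g1 g2 : mR -> R) (M : R) : 0 < M ->
  (forall x, 0 <= g1 x) -> (forall x, 0 <= g2 x) ->
  (forall x, ~~ (- M < x < M) -> g1 x = 0) ->
  (forall x, ~~ (- M < x < M) -> g2 x = 0) ->
  m1.-integrable setT (EFin \o g1) -> m2.-integrable setT (EFin \o g2) ->
  (forall k, \int[m1]_x (x ^+ k * g1 x) = \int[m2]_x (x ^+ k * g2 x)) ->
  forall A, measurable A ->
    (\int[m1]_(x in A) (g1 x)%:E = \int[m2]_(x in A) (g2 x)%:E)%E.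
Proof.
move=> M0 g10 g20 s1 s2 i1 i2 e A mA.
have mg1 : measurable_fun setT g1 by case/integrableP : i1 => /measurable_EFinP.
have mg2 : measurable_fun setT g2 by case/integrableP : i2 => /measurable_EFinP.
have fin1 B : measurable B -> (\int[m1]_(x in B) (g1 x)%:E)%E \is a fin_num.
  by move=> mB; apply: integrable_fin_num => //; exact: integrableS i1.
have fin2 B : measurable B -> (\int[m2]_(x in B) (g2 x)%:E)%E \is a fin_num.
  by move=> mB; apply: integrable_fin_num => //; exact: integrableS i2.
(* A ray starting at or left of [- M] carries the whole mass, which is the moment of order [0]. *)
have toR (m : {measure set mR -> \bar R}) g t : (forall x, ~~ (- M < x < M) -> g x = 0) ->
    t <= - M -> \int[m]_(x in `]t, +oo[) g x = \int[m]_x (x ^+ 0 * g x).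
  move=> sg tM; rewrite Rintegral_mkcond; apply: eq_Rintegral => x _.
  rewrite expr0 mul1r patchE mem_setE in_itv/= andbT; case: ltP => // xt.
  apply/esym/sg; rewrite negb_and -leNgt.
  by rewrite -leNgt (le_trans xt tM).
have ray t : \int[m1]_(x in `]t, +oo[) g1 x = \int[m2]_(x in `]t, +oo[) g2 x.
  have [tM|Mt] := leP t (- M); first by rewrite !toR.
  have h1 := cvg_Rintegral_step_poly M0 g10 s1 i1 Mt.
  have h2 := cvg_Rintegral_step_poly M0 g20 s2 i2 Mt.
  have E n : \int[m1]_x ((step_poly M t n).[x] * g1 x) =
      \int[m2]_x ((step_poly M t n).[x] * g2 x).
    rewrite (Rintegral_polyM M0 s1 i1) (Rintegral_polyM M0 s2 i2).
    by apply: eq_bigr => i _; rewrite e.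
  rewrite (funext E) in h1.
  by rewrite -(cvg_lim _ h1)// (cvg_lim _ h2).
apply: (@measure_unique _ _ mR (@RGenOInfty.G R) (fun k => `]- k%:R, +oo[%classic)
  _ _ _ _ (density m1 mg1 g10) (density m2 mg2 g20)) => //.
- exact: RGenOInfty.measurableE.
- move=> _ _ [x ->] [y ->]; exists (Num.max x y).
  by apply/seteqP; split => z /=; rewrite !in_itv/= !andbT gt_max; [move=> [-> ->]|move=> /andP].
- by move=> i; exists (- i%:R).
- rewrite -subTset => x _; exists (Num.truncn `|x|).+1 => //=.
  rewrite in_itv/= andbT ltrNl.
  have /andP[_ h] := truncn_itv (normr_ge0 x).
  by apply: le_lt_trans h; rewrite -normrN ler_norm.
- move=> _ [t ->]; rewrite /density/= /density_measure.
  rewrite -[LHS]fineK ?fin1// -[RHS]fineK ?fin2//.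
  by congr EFin; exact: ray.
- move=> k; rewrite /density/= /density_measure.
  by rewrite ltey_eq fin1.
Qed.

End determinacy.

(** * Integrating a derivative over an open interval *)

Section open_interval_FTC.
Context {R : realType}.
Local Notation mu := (@lebesgue_measure R).
Variables (a b A B : R) (f F : R -> R).
Hypotheses (ab : a < b).
Hypothesis dF : forall x, a < x < b -> is_derive x 1 F (f x).
Hypothesis cf : forall x, a < x < b -> {for x, continuous f}.
Hypotheses (FA : F x @[x --> a^'+] --> A) (FB : F x @[x --> b^'-] --> B).

(** The fundamental theorem applies on compact subintervals exhausting []a, b[], and monotone
    convergence gives the limit. *)
Lemma ge0_integral_itvoo_derive : (forall x, a < x < b -> 0 <= f x) ->
  (\int[mu]_(x in `]a, b[) (f x)%:E = (B - A)%:E)%E.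
Proof.
move=> f0.
(* As [harmonic n] is [1 / (n + 1)], the shift by [2] gives [e n <= (b - a) / 3], which keeps
   [a + e n < b - e n]. *)
pose e n : R := (b - a) * harmonic (n + 2)%N.
have e0 n : 0 < e n by rewrite /e /harmonic/= mulr_gt0 ?subr_gt0 ?invr_gt0.
have eD n : e n.+1 <= e n.
  by rewrite /e ler_wpM2l ?subr_ge0 ?(ltW ab)// /harmonic/= lef_pV2 ?posrE// ler_nat addSn.
have e2 n : e n * 3 <= b - a.
  rewrite /e -mulrA ler_piMr ?subr_ge0 ?(ltW ab)// /harmonic/= mulrC ler_pdivrMr//.
  by rewrite mul1r ler_nat addn2.
have ecvg : e n @[n --> \oo] --> 0.
  rewrite -[X in _ --> X](mulr0 (b - a)); apply: cvgMr.
  have := @cvg_harmonic R; by rewrite -(cvg_shiftn 2).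
pose I n := `[a + e n, b - e n]%classic.
have Isub n x : I n x -> a < x < b.
  rewrite /I/= in_itv/= => /andP[x1 x2]; have := e0 n; lra.
have Iint n : (\int[mu]_(x in I n) (f x)%:E = (F (b - e n) - F (a + e n))%:E)%E.
  have lt : a + e n < b - e n by have := e0 n; have := e2 n; lra.
  have dx x : a + e n <= x <= b - e n -> is_derive x 1 F (f x).
    by move=> h; apply: dF; apply: (Isub n); rewrite /I/= in_itv.
  have cF x : a + e n <= x <= b - e n -> {for x, continuous F}.
    by move=> /dx [h _]; apply: differentiable_continuous; apply/derivable1_diffP.
  rewrite /I (@continuous_FTC2 _ f F)//.
  - apply: continuous_in_subspaceT => x; rewrite inE => h.
    by apply: cf; exact: (Isub n).
  - split.
    + by move=> x; rewrite in_itv/= => /andP[/ltW h1 /ltW h2]; have [] := dx x _; rewrite ?h1.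
    + by apply: cvg_at_right_filter; apply: cF; rewrite lexx ltW.
    + by apply: cvg_at_left_filter; apply: cF; rewrite lexx ltW.
  - move=> x; rewrite in_itv/= => /andP[/ltW h1 /ltW h2].
    have d := dx x; rewrite h1 h2 in d.
    by rewrite derive1E; apply: derive_val; exact: d.
have IU : \bigcup_n I n = `]a, b[%classic.
  apply/seteqP; split => [x [n _ /Isub]|x]; first by rewrite /= in_itv.
  rewrite /= in_itv/= => /andP[ax xb].
  have [n _ h] : \forall n \near \oo, e n < Num.min (x - a) (b - x).
    have m0 : 0 < Num.min (x - a) (b - x) by rewrite lt_min !subr_gt0 ax.
    have := cvgr_lt _ ecvg _ m0; exact.
  exists n => //; have := h n (leqnn n); rewrite lt_min => /andP[h1 h2].
  by rewrite /I/= in_itv/=; apply/andP; split; lra.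
rewrite -IU.
have h : (\int[mu]_(x in I i) (f x)%:E)%E @[i --> \oo] -->
    (\int[mu]_(x in \bigcup_i I i) (f x)%:E)%E.
  apply: ge0_nondecreasing_set_cvg_integral.
  - apply/nondecreasing_seqP => n; rewrite subsetEset => x; rewrite /I/= !in_itv/=.
    by move=> /andP[x1 x2]; have := eD n; lra.
  - by move=> i; exact: measurable_itv.
  - move=> i; apply/measurable_EFinP.
    apply: (@measurable_funS _ _ _ _ `]a, b[%classic) => //.
      by move=> x /Isub; rewrite /= in_itv.
    apply: open_continuous_measurable_fun; first exact: interval_open.
    by move=> x; rewrite inE/= in_itv/=; exact: cf.
  - by move=> i x /Isub /f0; rewrite lee_fin.
rewrite -(cvg_lim _ h)//; apply/cvg_lim => //.
under eq_fun do rewrite Iint.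
apply: cvg_EFin; first exact: nearW.
have -> : fine \o (fun x => (F (b - e x) - F (a + e x))%:E) = (fun x => F (b - e x) - F (a + e x)) by [].
apply: cvgB.
- have /cvg_at_leftP := FB; apply; split => [n|].
    by rewrite gtrBl.
  by rewrite -[X in _ --> X]subr0; apply: cvgB => //; exact: cvg_cst.
- have /cvg_at_rightP := FA; apply; split => [n|].
    by rewrite ltrDl.
  by rewrite -[X in _ --> X]addr0; apply: cvgD => //; exact: cvg_cst.
Qed.

End open_interval_FTC.

Lemma integrable_itvoo {R : realType} (a b K : R) (f : R -> R) : a < b ->
  measurable_fun `]a, b[ f -> (forall x, a < x < b -> `|f x| <= K) ->
  lebesgue_measure.-integrable `]a, b[ (EFin \o f).
Proof.
move=> ab mf fK; apply: measurable_bounded_integrable => //.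
  by rewrite /= lebesgue_measure_itv/= lte_fin ab -EFinB ltry.
exists K; split; first exact: num_real.
move=> y Ky x /=; rewrite in_itv/= => /fK h; exact: le_trans h (ltW Ky).
Qed.

(** Adding [K] to the integrand and [K * x] to the primitive reduces this to the nonnegative
    case. *)
Lemma bounded_Rintegral_itvoo_derive {R : realType} (a b A B K : R) (f F : R -> R) :
  a < b -> (forall x, a < x < b -> is_derive x 1 F (f x)) ->
  (forall x, a < x < b -> {for x, continuous f}) ->
  F x @[x --> a^'+] --> A -> F x @[x --> b^'-] --> B ->
  (forall x, a < x < b -> `|f x| <= K) ->
  \int[lebesgue_measure]_(x in `]a, b[) f x = B - A.
Proof.
move=> ab dF cf FA FB fK.
have mf : measurable_fun `]a, b[ f.
  apply: open_continuous_measurable_fun; first exact: interval_open.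
  by move=> x; rewrite inE/= in_itv/=; exact: cf.
have fi := integrable_itvoo ab mf fK.
have Ki : lebesgue_measure.-integrable `]a, b[ (EFin \o cst K).
  apply: (@integrable_itvoo _ _ _ `|K|) => // x _; exact: measurable_cst.
have h : (\int[lebesgue_measure]_(x in `]a, b[) (f x + K)%:E = ((B + K * b) - (A + K * a))%:E)%E.
  apply: (@ge0_integral_itvoo_derive _ _ _ _ _ (fun x => f x + K) (fun x => F x + K * x)) => //.
  - by move=> x xab; have d := dF x xab; apply: is_derive_eq; rewrite scaler1.
  - by move=> x xab; apply: cvgD; [exact: cf|exact: cvg_cst].
  - apply: cvgD => //; apply: cvgMr; apply: cvg_at_right_filter; exact: cvg_id.
  - apply: cvgD => //; apply: cvgMr; apply: cvg_at_left_filter; exact: cvg_id.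
  - by move=> x xab; have := fK x xab; rewrite ler_norml; lra.
have /(congr1 fine) := h; rewrite -/(Rintegral _ _ _)/= RintegralD// Rintegral_cst//.
rewrite /= lebesgue_measure_itv/= lte_fin ab/= => h'; lra.
Qed.

(** * The arc on which (1 + w) ^ p / w is real *)

Section sine_bounds.
Context {R : realType}.
Implicit Types x : R.

Lemma sin_mean_value x : 0 < x -> exists2 c, 0 < c < x & sin x = cos c * x.
Proof.
move=> x0; have [] := @MVT R sin cos 0 x x0.
- by apply: derivable_within_continuous => y _; exact: derivable_sin.
- move=> c; rewrite in_itv/= sin0 !subr0 => c0 ->; by exists c.
Qed.

Lemma sin_le_id x : 0 <= x -> sin x <= x.
Proof.
rewrite le_eqVlt => /predU1P[<-|x0]; first by rewrite sin0.
have [c _ ->] := sin_mean_value x0.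
by rewrite ler_piMl ?(ltW x0)// cos_le1.
Qed.

(** Halving the angle and the mean value theorem give [sin x = x * cos c * cos (x / 2)] with
    [c < x / 2], which is at least [x * cos (x / 2) ^+ 2 = x * (1 + cos x) / 2]. *)
Lemma sin_ge_half x : 0 <= x <= pi / 2 -> x / 2 <= sin x.
Proof.
move=> /andP[]; rewrite le_eqVlt => /predU1P[<-|x0] xpi; first by rewrite sin0 mul0r.
have y0 : 0 < x / 2 by rewrite divr_gt0.
have [c /andP[c0 cy] sy] := sin_mean_value y0.
have cc : cos (x / 2) <= cos c.
  have pi0 := @pi_gt0 R.
  apply: ltW; rewrite ltr_cos ?in_itv/=; lra.
have cy0 : 0 <= cos (x / 2).
  by have pi0 := @pi_gt0 R; apply: cos_ge0_pihalf; lra.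
have cx0 : 0 <= cos x.
  by have pi0 := @pi_gt0 R; apply: cos_ge0_pihalf; lra.
have xE : x = x / 2 + x / 2 by lra.
have : sin x = 2 * (sin (x / 2) * cos (x / 2)) by rewrite {1}xE sinD; ring.
have c2 : cos x = 2 * cos (x / 2) ^+ 2 - 1.
  by rewrite {1}xE cosD; have := cos2Dsin2 (x / 2); lra.
move=> ->; rewrite sy.
have : cos (x / 2) * cos (x / 2) <= cos c * cos (x / 2) by rewrite ler_wpM2r.
rewrite -expr2; nra.
Qed.

Lemma is_derive_sinZ (c x : R) :
  is_derive x 1 (fun y => sin (c * y)) (c * cos (c * x)).
Proof. by apply: is_derive_eq; rewrite /GRing.scale/=; ring. Qed.

Lemma is_derive_ln_sin_ratio (c d x : R) : 0 < sin (c * x) -> 0 < sin (d * x) ->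
  is_derive x 1 (fun y => ln (sin (c * y) / sin (d * y)))
    (c * (cos (c * x) / sin (c * x)) - d * (cos (d * x) / sin (d * x))).
Proof.
move=> sc0 sd0.
have dV := @is_deriveV R (fun y => sin (d * y)) x _ 1 (lt0r_neq0 sd0) (is_derive_sinZ d x).
have dM := is_deriveM (is_derive_sinZ c x) dV.
have h := @is_derive1_comp R _ (fun y => sin (c * y) / sin (d * y)) x _ _
  (is_derive1_ln (divr_gt0 sc0 sd0)) dM.
by apply: (is_derive_eq h); rewrite /GRing.scale/=; field; rewrite !gt_eqF.
Qed.

End sine_bounds.

(* On the arc [0 < x < pi / p] the number [w] with argument [p * x] for which
   [1 + w] has argument [x] is [w = expR (ln_w x) * e^(i p x)], and
   [1 + w = expR (ln_v x) * e^(i x)]. *)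
Section arc.
Context {R : realType}.
Variable p : R.
Implicit Types x al ka : R.

Definition ln_v x : R := ln (sin (p * x) / sin ((p - 1) * x)).
Definition ln_w x : R := ln (sin x / sin ((p - 1) * x)).
Definition dln_w x : R :=
  cos x / sin x - (p - 1) * (cos ((p - 1) * x) / sin ((p - 1) * x)).

(* The imaginary part of [(1 + w) ^ al * w ^ (- ka) * (dw / w)]. *)
Definition arc_form al ka x : R := expR (al * ln_v x - ka * ln_w x) *
  (p * cos ((al - p * ka) * x) + dln_w x * sin ((al - p * ka) * x)).

Hypothesis p2 : 2 <= p.
Local Notation arc x := (0 < x < pi / p).

Let q1 : 1 <= p - 1. Proof. by rewrite lerBrDr. Qed.
Let p0 : 0 < p. Proof. exact: lt_le_trans p2. Qed.

Lemma arc_bounds x : arc x -> [/\ 0 < x, p * x < pi, x < pi / 2 & x <= (p - 1) * x].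
Proof.
move=> /andP[x0]; rewrite ltr_pdivlMr// mulrC => xp; split => //.
  by rewrite ltr_pdivlMr// mulrC (le_lt_trans _ xp)// ler_wpM2r// ltW.
by rewrite ler_peMl// ltW.
Qed.

Lemma arc_sin_gt0 x : arc x -> [/\ 0 < sin x, 0 < sin ((p - 1) * x) & 0 < sin (p * x)].
Proof.
move=> /arc_bounds[x0 xp xpi qx]; have pi0 := @pi_gt0 R.
have px : p * x = (p - 1) * x + x by ring.
by split; apply: sin_gt0_pi; lra.
Qed.

Lemma expR_ln_v x : arc x -> expR (ln_v x) = sin (p * x) / sin ((p - 1) * x).
Proof. by move=> /arc_sin_gt0[? ? ?]; rewrite lnK// posrE divr_gt0. Qed.

Lemma expR_ln_w x : arc x -> expR (ln_w x) = sin x / sin ((p - 1) * x).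
Proof. by move=> /arc_sin_gt0[? ? ?]; rewrite lnK// posrE divr_gt0. Qed.

Lemma arc_sinD x : sin (p * x) =
  sin ((p - 1) * x) * cos x + cos ((p - 1) * x) * sin x.
Proof. by rewrite -sinD; congr sin; ring. Qed.

Lemma arc_cosD x : cos (p * x) =
  cos ((p - 1) * x) * cos x - sin ((p - 1) * x) * sin x.
Proof. by rewrite -cosD; congr cos; ring. Qed.

(** The real part of [v = 1 + w], where [v] has modulus [expR (ln_v x)] and argument [x];
    [arc_sin_v] is the imaginary part. *)
Lemma arc_cos_v x : arc x ->
  expR (ln_v x) * cos x = 1 + expR (ln_w x) * cos (p * x).
Proof.
move=> xa; rewrite expR_ln_v// expR_ln_w//.
have [s0 sq0 sp0] := arc_sin_gt0 xa; rewrite arc_sinD arc_cosD.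
have := cos2Dsin2 x.
set s := sin x; set c := cos x; set sq := sin _; set cq := cos _ => cs.
have -> : 1 = (c ^+ 2 + s ^+ 2) :> R by [].
by field; rewrite gt_eqF.
Qed.

Lemma arc_sin_v x : arc x ->
  expR (ln_v x) * sin x = expR (ln_w x) * sin (p * x).
Proof.
move=> xa; rewrite expR_ln_v// expR_ln_w//.
by have [s0 sq0 sp0] := arc_sin_gt0 xa; field; rewrite gt_eqF.
Qed.

(** The difference [2 * cos x * sin ((p - 1) * x) - sin (p * x)] equals [sin ((p - 2) * x)],
    nonnegative on the arc. In polar coordinates the bound says that [1 + w] lies in the disk
    [|1 - z| <= 1]. *)
Lemma expR_ln_v_le x : arc x -> expR (ln_v x) <= 2 * cos x.
Proof.
move=> xa; rewrite expR_ln_v//; have [s0 sq0 sp0] := arc_sin_gt0 xa.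
rewrite ler_pdivrMr// arc_sinD.
have : 0 <= sin ((p - 1) * x - x).
  by have [x0 xp xpi qx] := arc_bounds xa; apply: sin_ge0_pi; nra.
by rewrite sinB; lra.
Qed.

Lemma ln_v_le x : arc x -> ln_v x <= ln 2.
Proof.
move=> xa; rewrite -ler_expR lnK ?posrE//.
by have := expR_ln_v_le xa; have := cos_le1 x; lra.
Qed.

(** The difference of the sines is [2 * cos (p * x / 2) * sin ((p / 2 - 1) * x)]. The bound amounts
    to [|w| <= 1]. *)
Lemma arc_sin_le x : arc x -> sin x <= sin ((p - 1) * x).
Proof.
move=> xa; have [x0 xp xpi qx] := arc_bounds xa.
pose A := p / 2 * x; pose B := (p / 2 - 1) * x.
have -> : (p - 1) * x = A + B by rewrite /A /B; field.
have {1}-> : x = A - B by rewrite /A /B; field.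
rewrite sinB sinD.
have cA : 0 <= cos A by apply: cos_ge0_pihalf; rewrite /A; have := @pi_gt0 R; nra.
have sB : 0 <= sin B by apply: sin_ge0_pi; rewrite /B; have := @pi_gt0 R; nra.
have := mulr_ge0 cA sB; lra.
Qed.

Lemma ln_w_le0 x : arc x -> ln_w x <= 0.
Proof.
move=> xa; rewrite -ler_expR expR0 expR_ln_w//.
have [s0 sq0 sp0] := arc_sin_gt0 xa.
by rewrite ler_pdivrMr// mul1r arc_sin_le.
Qed.

Lemma ln_w_ge x : arc x -> - ln (2 * (p - 1)) <= ln_w x.
Proof.
move=> xa; have [x0 xp xpi qx] := arc_bounds xa.
have [s0 sq0 sp0] := arc_sin_gt0 xa.
have q0 : 0 < 2 * (p - 1) by have := q1; lra.
rewrite -lnV ?posrE// -ler_expR expR_ln_w// lnK ?posrE ?invr_gt0//.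
rewrite ler_pdivlMr// mulrC ler_pdivrMr//.
have h1 : x / 2 <= sin x by apply: sin_ge_half; rewrite !ltW.
have h2 : sin ((p - 1) * x) <= (p - 1) * x by apply: sin_le_id; lra.
by apply: le_trans h2 _; have := q1; nra.
Qed.

Lemma normr_ln_w x : arc x -> `|ln_w x| <= ln (2 * (p - 1)).
Proof.
move=> xa; rewrite ler_norml ln_w_ge//= (le_trans (ln_w_le0 xa))// ln_ge0//.
by have := q1; lra.
Qed.

(** The numerator [N] of [dln_w] vanishes at [0] and its derivative is a nonnegative multiple of a
    product of two sines. So [N] is nonnegative and at most of order [x ^+ 3], against a denominator
    of at least [x ^+ 2 / 4]. *)
Lemma dln_w_bounds x : arc x -> 0 <= dln_w x <= 4 * (p - 1) * (p ^+ 2 - 2 * p) * pi.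
Proof.
have pm1 : 0 <= p - 1 by have := q1; lra.
have pi00 := @pi_ge0 R.
move=> xa; have [x0 xp xpi qx] := arc_bounds xa.
have [s0 sq0 sp0] := arc_sin_gt0 xa.
pose N y := cos y * sin ((p - 1) * y) - (p - 1) * (sin y * cos ((p - 1) * y)).
have dN (y : R) : is_derive y 1 N ((p ^+ 2 - 2 * p) * (sin y * sin ((p - 1) * y))).
  by apply: is_derive_eq; rewrite /GRing.scale/=; ring.
have [c] := @MVT R N (fun y => (p ^+ 2 - 2 * p) * (sin y * sin ((p - 1) * y))) 0 x x0
  (fun y _ => dN y) (derivable_within_continuous (fun y _ => @ex_derive _ _ _ _ _ _ _ (dN y))).
have N0 : N 0 = 0 by rewrite /N mulr0 sin0; ring.
rewrite in_itv/= N0 !subr0 => /andP[c0 cx] NE.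
have ca : arc c by rewrite c0/= (lt_trans cx)//; case/andP: xa.
have [sc0 sqc0 _] := arc_sin_gt0 ca.
have K0 : 0 <= p ^+ 2 - 2 * p by nra.
have -> : dln_w x = N x / (sin x * sin ((p - 1) * x)).
  by rewrite /dln_w /N; field; rewrite !gt_eqF.
rewrite NE.
have num0 : 0 <= (p ^+ 2 - 2 * p) * (sin c * sin ((p - 1) * c)) * x.
  by rewrite !mulr_ge0// ltW.
rewrite divr_ge0//=; last by rewrite mulr_ge0// ltW.
rewrite ler_pdivrMr ?mulr_gt0//.
have h1 : x / 2 <= sin x by apply: sin_ge_half; rewrite !ltW.
have h2 : sin x <= sin ((p - 1) * x) := arc_sin_le xa.
have h3 : sin c <= x by rewrite (le_trans (sin_le_id (ltW c0)))// ltW.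
have h4 : sin ((p - 1) * c) <= (p - 1) * x.
  have c1 : 0 <= (p - 1) * c by rewrite mulr_ge0 ?(ltW c0) ?(le_trans ler01).
  apply: le_trans (sin_le_id c1) _.
  by rewrite ler_wpM2l ?(ltW cx) ?(le_trans ler01).
have h5 : sin c * sin ((p - 1) * c) <= x * ((p - 1) * x) by rewrite ler_pM// ltW.
have h6 : (x / 2) * (x / 2) <= sin x * sin ((p - 1) * x).
  by apply: ler_pM; lra.
have pi0 := @pi_gt0 R.
apply: (@le_trans _ _ ((p ^+ 2 - 2 * p) * (x * ((p - 1) * x)) * x)).
  by rewrite ler_wpM2r ?(ltW x0)// ler_wpM2l.
apply: (@le_trans _ _ (4 * (p - 1) * (p ^+ 2 - 2 * p) * pi * ((x / 2) * (x / 2)))); last first.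
  by rewrite ler_wpM2l// !mulr_ge0.
have -> : (p ^+ 2 - 2 * p) * (x * ((p - 1) * x)) * x = ((p - 1) * (p ^+ 2 - 2 * p) * x ^+ 2) * x by ring.
have -> : 4 * (p - 1) * (p ^+ 2 - 2 * p) * pi * (x / 2 * (x / 2)) = ((p - 1) * (p ^+ 2 - 2 * p) * x ^+ 2) * pi by field.
apply: ler_wpM2l; last by lra.
by rewrite !mulr_ge0 ?(ltW x0).
Qed.

(** The imaginary part of [(1 + w) ^ al * w ^ (- ka)]. *)
Definition arc_primitive al ka x : R :=
  expR (al * ln_v x - ka * ln_w x) * sin ((al - p * ka) * x).

Lemma is_derive_ln_w x : arc x -> is_derive x 1 ln_w (dln_w x).
Proof.
move=> /arc_sin_gt0[s0 sq0 _]; have := @is_derive_ln_sin_ratio R 1 (p - 1) x.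
rewrite /dln_w !mul1r => /(_ s0 sq0); congr is_derive.
by apply/funext => y; rewrite mul1r.
Qed.

Lemma is_derive_ln_v x : arc x -> is_derive x 1 ln_v
  (p * (cos (p * x) / sin (p * x)) - (p - 1) * (cos ((p - 1) * x) / sin ((p - 1) * x))).
Proof. by move=> /arc_sin_gt0[_ sq0 sp0]; exact: is_derive_ln_sin_ratio. Qed.

(* Since [w = v - 1], the logarithmic derivatives of [v] and [w] are related by
   [v * (v' / v) = w * (w' / w)]. *)
Lemma is_derive_arc_primitive al ka x : arc x ->
  is_derive x 1 (arc_primitive al ka)
    (al * arc_form (al - 1) (ka - 1) x - ka * arc_form al ka x).
Proof.
move=> xa; have [s0 sq0 sp0] := arc_sin_gt0 xa.
have dv := is_derive_ln_v xa; have dw := is_derive_ln_w xa.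
have dl : is_derive x 1 (fun y => al * ln_v y - ka * ln_w y)
    (al * (p * (cos (p * x) / sin (p * x)) - (p - 1) * (cos ((p - 1) * x) / sin ((p - 1) * x))) - ka * dln_w x).
  by apply: is_derive_eq; rewrite /GRing.scale/=; ring.
have de := @is_derive1_comp R _ (fun y => al * ln_v y - ka * ln_w y) x _ _ (is_derive_expR (al * ln_v x - ka * ln_w x)) dl.
have ds : is_derive x 1 (fun y : R => sin ((al - p * ka) * y)) ((al - p * ka) * cos ((al - p * ka) * x)).
  by apply: is_derive_eq; rewrite /GRing.scale/=; ring.
apply: (is_derive_eq (is_deriveM de ds)).
rewrite /arc_form /GRing.scale/=.
have -> : al - 1 - p * (ka - 1) = (al - p * ka) + (p - 1) by ring.
have -> : (al - 1) * ln_v x - (ka - 1) * ln_w x = (al * ln_v x - ka * ln_w x) + ln_w x - ln_v x by ring.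
set A := al * ln_v x - ka * ln_w x.
rewrite (expRB (A + _)) (expRD A) (mulrDl _ (p - 1)) cosD sinD expR_ln_v// expR_ln_w// /dln_w.
have := arc_sinD x; have := arc_cosD x; have := cos2Dsin2 x.
move: sp0 sq0 s0.
set s := sin x; set c := cos x; set sq := sin ((p - 1) * x); set cq := cos ((p - 1) * x).
set sp := sin (p * x); set cp := cos (p * x).
set e := expR A; set sg := sin _; set cg := cos _ => sp0 sq0 s0 cs cpE spE.
(* [e1] and [e2] are the real and imaginary parts of [v' / v = (w / v) * (w' / w)]: here [w / v] has
   modulus [s / sp] and argument [(p - 1) * x], while [w' / w] is [dln_w x + i p]. The imaginary
   part of [v' / v] is [1], the derivative of the argument [x]. *)
have e1 : p * (cp / sp) - (p - 1) * (cq / sq) =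
    s / sp * ((c / s - (p - 1) * (cq / sq)) * cq - p * sq).
  rewrite cpE; have spn : sp != 0 by rewrite gt_eqF.
  have sn : s != 0 by rewrite gt_eqF.
  have sqn : sq != 0 by rewrite gt_eqF.
  apply: (mulIf spn); rewrite mulrBl.
  have -> : p * ((cq * c - sq * s) / sp) * sp = p * (cq * c - sq * s) by field.
  have -> : s / sp * ((c / s - (p - 1) * (cq / sq)) * cq - p * sq) * sp =
    ((c - (p - 1) * (cq / sq) * s) * cq - p * sq * s) by field; rewrite ?spn ?sqn ?sn.
  by rewrite spE; field.
have e2 : 1 = s / sp * (p * cq + (c / s - (p - 1) * (cq / sq)) * sq) :> R.
  have spn : sp != 0 by rewrite gt_eqF.
  have sn : s != 0 by rewrite gt_eqF.
  have sqn : sq != 0 by rewrite gt_eqF.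
  apply: (mulIf spn).
  have -> : s / sp * (p * cq + (c / s - (p - 1) * (cq / sq)) * sq) * sp =
    (p * cq * s + c * sq - (p - 1) * cq * s) by field; rewrite ?spn ?sqn ?sn.
  by rewrite spE; ring.
have -> : e * (s / sq) / (sp / sq) = e * (s / sp).
  by field; rewrite !gt_eqF.
set a := c / s - _ in e1 e2 *.
have -> : e * (s / sp) * (p * (cg * cq - sg * sq) + a * (sg * cq + cg * sq)) =
  e * (cg * (s / sp * (p * cq + a * sq)) + sg * (s / sp * (a * cq - p * sq))) by ring.
by rewrite -e1 -e2; ring.
Qed.

(** From [v = 1 + w] follows [v ^ (al + 1) * w ^ (- ka) = v ^ al * w ^ (- ka) + v ^ al * w ^ (1 -
    ka)]. *)
Lemma arc_formD al ka x : arc x ->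
  arc_form (al + 1) ka x = arc_form al ka x + arc_form al (ka - 1) x.
Proof.
move=> xa; have cv := arc_cos_v xa; have sv := arc_sin_v xa; rewrite /arc_form.
have -> : (al + 1) * ln_v x - ka * ln_w x = (al * ln_v x - ka * ln_w x) + ln_v x by ring.
have -> : al * ln_v x - (ka - 1) * ln_w x = (al * ln_v x - ka * ln_w x) + ln_w x by ring.
have -> : al + 1 - p * ka = (al - p * ka) + 1 by ring.
have -> : al - p * (ka - 1) = (al - p * ka) + p by ring.
set A := al * ln_v x - ka * ln_w x.
rewrite !(expRD A) (mulrDl _ 1 x) (mulrDl _ p x) mul1r !cosD !sinD.
set e := expR A; set g := (al - p * ka) * x.
have -> : e * expR (ln_v x) * (p * (cos g * cos x - sin g * sin x) +
   dln_w x * (sin g * cos x + cos g * sin x)) =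
   e * (p * (cos g * (expR (ln_v x) * cos x) - sin g * (expR (ln_v x) * sin x)) +
   dln_w x * (sin g * (expR (ln_v x) * cos x) + cos g * (expR (ln_v x) * sin x))) by ring.
by rewrite cv sv; ring.
Qed.

End arc.

(** * The contour integral *)

Lemma squeeze_cvg0 {T : Type} {R : realType} {F : set_system T} {FF : Filter F}
    (f g : T -> R) :
  (\forall x \near F, `|f x| <= g x) -> g x @[x --> F] --> 0 -> f x @[x --> F] --> 0.
Proof.
move=> fg g0; apply: (@squeeze_cvgr _ _ _ _ (fun x => - g x) g) => //.
  by apply: filterS fg => x; rewrite ler_norml.
by rewrite -[X in _ --> X]oppr0; exact: cvgN.
Qed.

Section arc_integral.
Context {R : realType}.
Variable p : R.
Hypothesis p2 : 2 <= p.
Implicit Types x al ka : R.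
Local Notation arc x := (0 < x < pi / p).
Local Notation mu := (@lebesgue_measure R).

Definition arc_integral al ka : R := \int[mu]_(x in `]0, pi / p[) arc_form p al ka x.

Let p0 : 0 < p. Proof. exact: lt_le_trans p2. Qed.
Let b0 : 0 < pi / p. Proof. by rewrite divr_gt0// pi_gt0. Qed.

Lemma continuous_ln_v x : arc x -> {for x, continuous (ln_v p)}.
Proof.
by move=> /(is_derive_ln_v p2) [h _]; apply: differentiable_continuous; apply/derivable1_diffP.
Qed.

Lemma continuous_ln_w x : arc x -> {for x, continuous (ln_w p)}.
Proof.
by move=> /(is_derive_ln_w p2) [h _]; apply: differentiable_continuous; apply/derivable1_diffP.
Qed.

Lemma cvg_cosZ (c x : R) : cos (c * y) @[y --> x] --> cos (c * x).
Proof.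
apply: continuous_comp; last exact: continuous_cos.
by apply: cvgMr; exact: cvg_id.
Qed.

Lemma cvg_sinZ (c x : R) : sin (c * y) @[y --> x] --> sin (c * x).
Proof.
apply: continuous_comp; last exact: continuous_sin.
by apply: cvgMr; exact: cvg_id.
Qed.

Lemma continuous_dln_w x : arc x -> {for x, continuous (dln_w p)}.
Proof.
move=> /(arc_sin_gt0 p2)[s0 sq0 _].
apply: cvgB.
  by apply: cvgM; [exact: continuous_cos|apply: cvgV; [rewrite gt_eqF|exact: continuous_sin]].
apply: cvgMr; apply: cvgM; first exact: cvg_cosZ.
by apply: cvgV; [rewrite gt_eqF|exact: cvg_sinZ].
Qed.

Lemma continuous_arc_form al ka x : arc x -> {for x, continuous (arc_form p al ka)}.
Proof.
move=> xa; apply: cvgM.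
  apply: continuous_comp; last exact: continuous_expR.
  by apply: cvgB; apply: cvgMr; [exact: continuous_ln_v|exact: continuous_ln_w].
apply: cvgD; first by apply: cvgMr; exact: cvg_cosZ.
by apply: cvgM; [exact: continuous_dln_w|exact: cvg_sinZ].
Qed.

Definition arc_bound al ka : R := expR (al * ln 2 + `|ka| * ln (2 * (p - 1))).

(** [ln_v] is bounded above only, as [v] tends to [0] at the end of the arc; hence the sign
    condition on [al]. [ln_w] is bounded on both sides, so [ka] may have either sign. *)
Lemma arc_expR_le al ka x : arc x -> 0 <= al ->
  expR (al * ln_v p x - ka * ln_w p x) <= arc_bound al ka.
Proof.
move=> xa al0; rewrite ler_expR lerD//.
  by rewrite ler_wpM2l// ln_v_le.
by rewrite (le_trans (ler_norm _))// normrN normrM ler_wpM2l// normr_ln_w.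
Qed.

Definition dln_w_bound : R := 4 * (p - 1) * (p ^+ 2 - 2 * p) * pi.

Lemma arc_form_bounded al ka x : arc x -> 0 <= al ->
  `|arc_form p al ka x| <= arc_bound al ka * (p + dln_w_bound).
Proof.
move=> xa al0; rewrite /arc_form normrM ler_pM//.
  by rewrite ger0_norm ?expR_ge0// arc_expR_le.
rewrite (le_trans (ler_normD _ _))// lerD//.
  rewrite normrM gtr0_norm// ler_piMr ?(ltW p0)//.
  by rewrite ler_norml cos_geN1 cos_le1.
have /andP[d0 dK] := dln_w_bounds p2 xa.
rewrite normrM ger0_norm// (le_trans _ dK)// ler_piMr//.
by rewrite ler_norml sin_geN1 sin_le1.
Qed.

Lemma measurable_arc_form al ka : measurable_fun `]0, pi / p[ (arc_form p al ka).
Proof.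
apply: open_continuous_measurable_fun; first exact: interval_open.
by move=> x; rewrite inE/= in_itv/=; exact: continuous_arc_form.
Qed.

Lemma integrable_arc_form al ka : 0 <= al ->
  mu.-integrable `]0, pi / p[ (EFin \o arc_form p al ka).
Proof.
move=> al0; apply: integrable_itvoo => //; first exact: measurable_arc_form.
by move=> x xa; exact: arc_form_bounded.
Qed.

Lemma cvg_arc_primitive0 al ka : 0 <= al ->
  arc_primitive p al ka x @[x --> 0^'+] --> 0.
Proof.
move=> al0.
apply: (@squeeze_cvg0 _ _ _ _ _ (fun x => arc_bound al ka * `|sin ((al - p * ka) * x)|)).
  near=> x; rewrite /arc_primitive normrM ler_wpM2r// ger0_norm ?expR_ge0//.
  by apply: arc_expR_le => //; apply/andP; split; near: x; [exact: nbhs_right_gt|exact: nbhs_right_lt].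
rewrite -[X in _ --> X](mulr0 (arc_bound al ka)); apply: cvgMr.
rewrite -[X in _ --> X](normr0 R); apply: cvg_norm.
apply: cvg_at_right_filter.
by have := @cvg_sinZ (al - p * ka) 0; rewrite mulr0 sin0.
Unshelve. all: by end_near.
Qed.

(** For [al >= 1] one factor [expR (ln_v x)] splits off; it tends to [0] because [sin (p * x)] does,
    and the rest stays bounded. *)
Lemma cvg_arc_primitive_end al ka : 1 <= al ->
  arc_primitive p al ka x @[x --> (pi / p)^'-] --> 0.
Proof.
move=> al1; have al0 : 0 <= al - 1 by rewrite subr_ge0.
apply: (@squeeze_cvg0 _ _ _ _ _ (fun x => arc_bound (al - 1) ka *
  (sin (p * x) / sin ((p - 1) * x)))).
  near=> x.
  have xa : arc x by apply/andP; split; near: x; [exact: nbhs_left_gt|exact: nbhs_left_lt].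
  rewrite -expR_ln_v// /arc_primitive normrM ger0_norm ?expR_ge0//.
  have -> : al * ln_v p x - ka * ln_w p x = ((al - 1) * ln_v p x - ka * ln_w p x) + ln_v p x by ring.
  rewrite expRD (le_trans (_ : _ <= expR ((al - 1) * ln_v p x - ka * ln_w p x) * expR (ln_v p x)))//.
    by rewrite ler_piMr ?mulr_ge0 ?expR_ge0// ler_norml sin_geN1 sin_le1.
  by rewrite ler_wpM2r ?expR_ge0// arc_expR_le.
rewrite -[X in _ --> X](mulr0 (arc_bound (al - 1) ka)); apply: cvgMr.
have s0 : 0 < sin ((p - 1) * (pi / p)).
  have -> : (p - 1) * (pi / p) = pi - pi / p by field; rewrite gt_eqF.
  apply: sin_gt0_pi; rewrite subr_gt0 ltrBlDr ltrDl b0 andbT.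
  by rewrite ltr_pdivrMr// ltr_pMr ?pi_gt0 ?(lt_le_trans _ p2) ?ltr1n.
have -> : 0 = sin (p * (pi / p)) / sin ((p - 1) * (pi / p)) :> R.
  by rewrite (mulrC p) divfK ?gt_eqF// sinpi mul0r.
apply: cvg_at_left_filter.
by apply: cvgM; [exact: cvg_sinZ|apply: cvgV; [rewrite gt_eqF|exact: cvg_sinZ]].
Unshelve. all: by end_near.
Qed.

(** The primitive vanishes at both ends of the arc, so its derivative integrates to [0]. This is the
    analogue of [k C(al, k) = al C(al - 1, k - 1)]. *)
Lemma arc_integral_rec al ka : 1 <= al ->
  ka * arc_integral al ka = al * arc_integral (al - 1) (ka - 1).
Proof.
move=> al1; have al0 : 0 <= al - 1 by rewrite subr_ge0.
have al0' : 0 <= al by lra.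
have i1 := integrable_arc_form ka al0'; have i2 := integrable_arc_form (ka - 1) al0.
have m1 : mu.-integrable `]0, pi / p[ (EFin \o (fun x => ka * arc_form p al ka x)).
  by have := integrableZl _ ka i1; apply; exact: measurable_itv.
have m2 : mu.-integrable `]0, pi / p[
    (EFin \o (fun x => al * arc_form p (al - 1) (ka - 1) x)).
  by have := integrableZl _ al i2; apply; exact: measurable_itv.
apply/esym/eqP; rewrite -subr_eq0 /arc_integral -!RintegralZl// -RintegralB//.
apply/eqP; rewrite -[RHS](subr0 0).
apply: (@bounded_Rintegral_itvoo_derive _ _ _ _ _
  (al * (arc_bound (al - 1) (ka - 1) * (p + dln_w_bound)) + `|ka| * (arc_bound al ka * (p + dln_w_bound)))
  _ (arc_primitive p al ka)) => //.
- by move=> x; exact: is_derive_arc_primitive.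
- by move=> x xa; apply: cvgB; apply: cvgMr; exact: continuous_arc_form.
- exact: cvg_arc_primitive0.
- exact: cvg_arc_primitive_end.
- move=> x xa; rewrite (le_trans (ler_normB _ _))// !(normrM _ (arc_form p _ _ x)) (ger0_norm al0').
  by apply: lerD; apply: ler_wpM2l => //; exact: arc_form_bounded.
Qed.

Lemma arc_integralD al ka : 0 <= al ->
  arc_integral (al + 1) ka = arc_integral al ka + arc_integral al (ka - 1).
Proof.
move=> al0; rewrite /arc_integral -RintegralD//; try exact: integrable_arc_form.
by apply: eq_Rintegral => x; rewrite inE/= in_itv/=; exact: arc_formD.
Qed.

Lemma arc_integral00 : arc_integral 0 0 = pi.
Proof.
rewrite /arc_integral (@eq_Rintegral _ _ _ mu _ (cst p)); last first.
  by move=> x _; rewrite /arc_form !(mul0r, mulr0, subr0) expR0 cos0 sin0 /=; ring.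
rewrite Rintegral_cst//= lebesgue_measure_itv/= lte_fin b0/= subr0.
by rewrite mulrC divfK// gt_eqF.
Qed.

(** The recursion at [ka = 0] reads [0 = (m + 1) * arc_integral m (- 1)], so the second term in
    [arc_integralD] vanishes and the value does not change with [m]. *)
Lemma arc_integral_nat (m : nat) : arc_integral m%:R 0 = pi.
Proof.
elim: m => [|m IH]; first exact: arc_integral00.
rewrite -natr1 arc_integralD// IH.
have := @arc_integral_rec (m%:R + 1) 0; rewrite lerDr ler0n mul0r => /(_ isT)/esym/eqP.
rewrite mulf_eq0 addrK natr1 pnatr_eq0/= => /eqP ->; exact: addr0.
Qed.

End arc_integral.

(** * Square roots by polynomial iteration *)

Section visser.
Context {R : realType}.
Local Open Scope complex_scope.
Implicit Types (z w : R[i]) (n j : nat).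
Local Notation normc := (@Normc.normc R).
Local Arguments Normc.normc : simpl never.

(* Visser's iteration: [1 - visser z n] tends to the principal square root of
   [z] as soon as [|1 - z| <= 1]. *)
Fixpoint visser z n : R[i] :=
  if n is k.+1 then 2^-1 * (1 - z + visser z k ^+ 2) else 0.

(** The iteration at [z = 0], which majorizes [visser z] in modulus on the disk [|1 - z| <= 1]. *)
Fixpoint visser1 n : R := if n is k.+1 then 2^-1 * (1 + visser1 k ^+ 2) else 0.

Fixpoint visser_poly n : {poly R} :=
  if n is k.+1 then 2^-1 *: (1 - 'X + visser_poly k ^+ 2) else 0.

Lemma visser_polyE z n : (map_poly (real_complex R) (visser_poly n)).[z] = visser z n.
Proof.
elim: n => [|n IH] /=; first by rewrite rmorph0 horner0.
rewrite map_polyZ rmorphD rmorphB rmorph1 rmorphXn /= map_polyX.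
rewrite hornerZ !hornerE IH; congr (_ * _).
by rewrite fmorphV rmorph_nat.
Qed.

(** At [z = 1] the iteration stays at its initial value. Thus the coefficients of any power of
    [1 - visser_poly n] sum to [1]. *)
Lemma visser_poly1 n : (visser_poly n).[1] = 0.
Proof. by elim: n => [|n IH] /=; rewrite !hornerE// IH; ring. Qed.

Lemma visser1_bounds n : 0 <= visser1 n <= 1.
Proof. by elim: n => [|n /andP[? ?]] /=; [rewrite lexx ler01|apply/andP; split; nra]. Qed.

(** The defect [d = 1 - visser1 n] evolves by [d - d ^+ 2 / 2], which is nondecreasing in [d] on
    [[0, 1]] and sends [2 / (n + 2)] below [2 / (n + 3)]. *)
Lemma visser1_ge n : 1 - visser1 n <= 2 / n.+2%:R.
Proof.
elim: n => [|n IH] /=; first by rewrite subr0 divff.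
have /andP[v0 v1] := visser1_bounds n.
have n0 : 0 < n%:R + 2 :> R by rewrite ltr_wpDl.
have n1 : 0 < n%:R + 3 :> R by rewrite ltr_wpDl.
rewrite -[n.+2]addn2 natrD in IH.
rewrite -[n.+3]addn3 natrD.
set m := n%:R in IH n0 n1 *; set d := 1 - visser1 n in IH.
have -> : visser1 n = 1 - d by rewrite /d; ring.
have d0 : 0 <= d by rewrite /d; lra.
have d1 : d <= 1 by rewrite /d; lra.
pose t := 2 / (m + 2).
have m0 : 0 <= m by rewrite ler0n.
have t1 : t <= 1 by rewrite /t ler_pdivrMr//; lra.
have -> : 1 - 2^-1 * (1 + (1 - d) ^+ 2) = d - d ^+ 2 / 2 by field.
have : d - d ^+ 2 / 2 <= t - t ^+ 2 / 2.
  rewrite -subr_ge0.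
  have -> : t - t ^+ 2 / 2 - (d - d ^+ 2 / 2) = (t - d) * (1 - (t + d) / 2) by field.
  by rewrite mulr_ge0 ?subr_ge0//; lra.
move=> /le_trans; apply; rewrite /t ler_pdivlMr//.
have -> : (2 / (m + 2) - (2 / (m + 2)) ^+ 2 / 2) * (m + 3) =
   (2 * (m + 1) * (m + 3)) / (m + 2) ^+ 2 by field; rewrite gt_eqF.
by rewrite ler_pdivrMr ?exprn_gt0//; nra.
Qed.

Lemma cnorm_ge0 z : 0 <= normc z.
Proof. by case: z => a b; exact: sqrtr_ge0. Qed.

Lemma ler_cnormD z w : normc (z + w) <= normc z + normc w.
Proof. exact: (@le_normcD R z w). Qed.

Lemma cnorm_half z : normc (2^-1 * z) = 2^-1 * normc z.
Proof.
rewrite Normc.normcM Normc.normcV; congr (_^-1 * _).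
have := @normcMn R 1 2; rewrite Normc.normc1 => <-.
by congr normc.
Qed.

Lemma visser_bound z n : normc (1 - z) <= 1 -> normc (visser z n) <= visser1 n.
Proof.
move=> z1; elim: n => [|n IH] /=; first by rewrite Normc.normc0.
rewrite cnorm_half ler_wpM2l// (le_trans (ler_cnormD _ _))// lerD//.
by rewrite expr2 Normc.normcM expr2 ler_pM// ?cnorm_ge0.
Qed.

(** As [w ^+ 2 = z], the new error is half the old one times [1 - w + visser z n]. The defect
    [1 - visser1 n] obeys the same recursion with factor [1 + visser1 n], a bound for the complex
    factor. *)
Lemma visser_error z w n : w ^+ 2 = z -> normc (1 - z) <= 1 -> normc (1 - w) <= 1 ->
  normc ((1 - w) - visser z n) <= 1 - visser1 n.
Proof.
move=> wz z1 w1; elim: n => [|n IH] /=; first by rewrite !subr0.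
have -> : 1 - w - 2^-1 * (1 - z + visser z n ^+ 2) =
   2^-1 * ((1 - w - visser z n) * (1 - w + visser z n)).
  by rewrite -wz; field.
rewrite cnorm_half Normc.normcM.
have -> : 1 - 2^-1 * (1 + visser1 n ^+ 2) = 2^-1 * ((1 - visser1 n) * (1 + visser1 n)) by field.
rewrite ler_wpM2l// ler_pM ?cnorm_ge0//.
by rewrite (le_trans (ler_cnormD _ _))// lerD// visser_bound.
Qed.

Lemma normc_exprB j : exists2 C : R, 0 <= C & forall x y : R[i],
  normc x <= 2 -> normc y <= 2 -> normc (x ^+ j - y ^+ j) <= C * normc (x - y).
Proof.
elim: j => [|j [C C0 IH]].
  by exists 0 => // x y _ _; rewrite !expr0 subrr Normc.normc0 mul0r.
exists (2 * C + 2 ^+ j) => [|x y x2 y2]; first by rewrite addr_ge0// ?mulr_ge0// exprn_ge0.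
have -> : x ^+ j.+1 - y ^+ j.+1 = x * (x ^+ j - y ^+ j) + y ^+ j * (x - y).
  by rewrite !exprS; ring.
rewrite (le_trans (ler_cnormD _ _))// !Normc.normcM mulrDl -mulrA lerD//.
  by rewrite ler_pM ?cnorm_ge0// IH.
rewrite ler_wpM2r ?cnorm_ge0//.
elim: (j) => [|k IHk]; first by rewrite !expr0 Normc.normc1.
by rewrite !exprS Normc.normcM ler_pM ?cnorm_ge0.
Qed.

End visser.

Section real_exponents.
Context {R : realType}.
Variable p : R.
Hypothesis p2 : 2 <= p.
Local Open Scope complex_scope.
Local Notation normc := (@Normc.normc R).
Local Arguments Normc.normc : simpl never.
Implicit Types (x t : R) (z : R[i]) (n j : nat).
Local Notation arc x := (0 < x < pi / p).
Local Notation mu := (@lebesgue_measure R).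

Let p0 : 0 < p. Proof. exact: lt_le_trans p2. Qed.

(** The branch of [(1 + w) ^ t] with argument [t * x]. *)
Definition v_pow t x : R[i] :=
  (expR (t * ln_v p x) * cos (t * x)) +i* (expR (t * ln_v p x) * sin (t * x)).

(** The imaginary part of [z * (dw / w)], a real-linear form in [z]. *)
Definition arc_lin x z : R := p * complex.Re z + dln_w p x * complex.Im z.

Lemma v_powX t x j : v_pow t x ^+ j = v_pow (j%:R * t) x.
Proof.
elim: j => [|j IH].
  by rewrite expr0 /v_pow !mul0r expR0 cos0 sin0 mulr1 mulr0.
rewrite exprS IH /v_pow -natr1 !mulrDl !mul1r expRD cosD sinD.
by apply/eqP; rewrite eq_complex/=; apply/andP; split; apply/eqP; ring.
Qed.

Lemma arc_lin_v_pow t x : arc_lin x (v_pow t x) = arc_form p t 0 x.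
Proof. by rewrite /arc_lin /arc_form /v_pow/= mul0r mulr0 !subr0; ring. Qed.

Lemma arc_linD x z1 z2 : arc_lin x (z1 + z2) = arc_lin x z1 + arc_lin x z2.
Proof. by case: z1 z2 => [a b] [c d]; rewrite /arc_lin /=; ring. Qed.

Lemma arc_linZ x (c : R) z : arc_lin x (c%:C * z) = c * arc_lin x z.
Proof. by case: z => [a b]; rewrite /arc_lin /=; ring. Qed.

Lemma arc_lin_horner (Q : {poly R}) t x :
  arc_lin x (map_poly (real_complex R) Q).[v_pow t x] =
  \sum_(i < size Q) Q`_i * arc_form p (i%:R * t) 0 x.
Proof.
rewrite horner_coef size_map_poly (big_morph _ (arc_linD x) (_ : arc_lin x 0 = 0)).
  by apply: eq_bigr => i _; rewrite coef_map/= v_powX arc_linZ arc_lin_v_pow.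
by rewrite /arc_lin/= !mulr0 addr0.
Qed.

Lemma normr_arc_lin x z : arc x -> `|arc_lin x z| <= (p + dln_w_bound p) * normc z.
Proof.
move=> xa; have /andP[d0 dK] := dln_w_bounds p2 xa.
have [hRe hIm] : `|complex.Re z| <= normc z /\ `|complex.Im z| <= normc z.
  case: z => a b; rewrite /Normc.normc/= -!sqrtr_sqr.
  by split; rewrite ler_sqrt ?addr_ge0 ?sqr_ge0// ?lerDl ?lerDr sqr_ge0.
rewrite /arc_lin (mulrDl p); apply: le_trans (ler_normD _ _) _; apply: lerD.
  by rewrite normrM (gtr0_norm p0) ler_wpM2l// ltW.
by rewrite normrM (ger0_norm d0) ler_pM.
Qed.

(** With modulus [r] and cosine [c] of the argument, the squared norm is [1 - r * (2 * c - r)]. *)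
Lemma cnorm_1Bv_pow t x : expR (t * ln_v p x) <= 2 * cos (t * x) ->
  normc (1 - v_pow t x) <= 1.
Proof.
set r := expR _ => h; have r0 : 0 <= r by exact: expR_ge0.
rewrite /v_pow /Normc.normc -[leRHS]sqrtr1 ler_sqrt//.
have := cos2Dsin2 (t * x); rewrite -/r /=.
set c := cos _; set s := sin _ => cs.
have -> : (1 - r * c) ^+ 2 + (0 - r * s) ^+ 2 = 1 - r * (2 * c - r * (c ^+ 2 + s ^+ 2)) by ring.
by rewrite cs mulr1 gerBl mulr_ge0// subr_ge0.
Qed.

(** The disk [|1 - z| <= 1] is stable under this square root: [r ^+ 2 <= 2 * (c ^+ 2 - s ^+ 2)]
    implies [r ^+ 2 <= (2 * c) ^+ 2], and [c >= 0]. *)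
Lemma v_pow_half_disk t x : arc x -> 0 <= t <= 1 ->
  expR (t * ln_v p x) <= 2 * cos (t * x) ->
  expR (t / 2 * ln_v p x) <= 2 * cos (t / 2 * x).
Proof.
move=> xa /andP[t0 t1] h; have [x0 xp xpi qx] := arc_bounds p2 xa.
have c0 : 0 <= cos (t / 2 * x).
  by apply: cos_ge0_pihalf; have := @pi_gt0 R; nra.
have hD : t * x = t / 2 * x + t / 2 * x by field.
have eD : t * ln_v p x = t / 2 * ln_v p x + t / 2 * ln_v p x by field.
move: h; rewrite eD expRD hD cosD.
have := cos2Dsin2 (t / 2 * x); have := expR_gt0 (t / 2 * ln_v p x).
move: c0; set c := cos _; set s := sin _; set r := expR _ => c0 r0 cs h.
have h2 : r ^+ 2 <= (2 * c) ^+ 2 by have := sqr_ge0 s; rewrite exprMn; nra.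
by rewrite -ler_sqr ?nnegrE ?mulr_ge0 ?(ltW r0).
Qed.

(** By linearity, a real polynomial [Q] in [v_pow t] integrates against the form to [pi * Q.[1]].
    The polynomials [Q n] below have value [1] at [1] and converge boundedly to the [j]-th power of
    the square root, so the limit is again [pi]. *)
Lemma arc_integral_half t : 0 <= t <= 1 ->
  (forall x, arc x -> expR (t * ln_v p x) <= 2 * cos (t * x)) ->
  (forall j, arc_integral p (j%:R * t) 0 = pi) ->
  forall j, arc_integral p (j%:R * (t / 2)) 0 = pi.
Proof.
move=> t01 ht It j; have /andP[t0 t1] := t01.
pose Q n : {poly R} := (1 - visser_poly n) ^+ j.
have QE n x : arc x -> \sum_(i < size (Q n)) (Q n)`_i * arc_form p (i%:R * t) 0 x =
    arc_lin x ((1 - visser (v_pow t x) n) ^+ j).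
  by move=> xa; rewrite -arc_lin_horner /Q rmorphXn rmorphB rmorph1 /= !hornerE visser_polyE.
have vn n x : arc x -> normc (1 - visser (v_pow t x) n) <= 2.
  move=> xa; rewrite (le_trans (ler_cnormD _ _))// Normc.normc1 normcN.
  have v1 := visser_bound n (cnorm_1Bv_pow (ht x xa)).
  have /andP[_ v2] := @visser1_bounds R n.
  by rewrite -[leRHS]/(1 + 1) lerD2l (le_trans v1).
have wn x : arc x -> normc (v_pow (t / 2) x) <= 2.
  move=> xa; have := cnorm_1Bv_pow (v_pow_half_disk xa t01 (ht x xa)) => h.
  have -> : v_pow (t / 2) x = 1 + - (1 - v_pow (t / 2) x) by ring.
  by rewrite (le_trans (ler_cnormD _ _))// Normc.normc1 normcN -[leRHS]/(1 + 1) lerD2l.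
have ii n (i : 'I_(size (Q n))) : mu.-integrable `]0, pi / p[
    (EFin \o (fun x => (Q n)`_i * arc_form p (i%:R * t) 0 x)).
  have h : mu.-integrable `]0, pi / p[ (EFin \o arc_form p (i%:R * t) 0).
    by apply: integrable_arc_form => //; rewrite mulr_ge0.
  by have := integrableZl _ ((Q n)`_i) h; apply; exact: measurable_itv.
have In n : \int[mu]_(x in `]0, pi / p[)
    (\sum_(i < size (Q n)) (Q n)`_i * arc_form p (i%:R * t) 0 x) = pi.
  rewrite (Rintegral_sum _ _ (ii n))//.
  under eq_bigr => i _.
    rewrite RintegralZl//; last by apply: integrable_arc_form => //; rewrite mulr_ge0.
    have := It i; rewrite /arc_integral => ->; over.
  rewrite -mulr_suml.
  have -> : \sum_(i < size (Q n)) (Q n)`_i = (Q n).[1].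
    by rewrite horner_coef; apply: eq_bigr => i _; rewrite expr1n mulr1.
  by rewrite /Q !hornerE visser_poly1 subr0 expr1n mul1r.
(* The modulus of [1 - visser (v_pow t x) n] is at most [2], whence the factor [2 ^+ j] in the
   dominating constant. *)
pose K := (p + dln_w_bound p) * 2 ^+ j.
have K0 : 0 <= p + dln_w_bound p.
  have b0 : 0 < pi / p / 2 < pi / p.
    by have := divr_gt0 (@pi_gt0 R) p0; lra.
  have := dln_w_bounds p2 b0; rewrite /dln_w_bound; have := p0; lra.
have cv : \int[mu]_(x in `]0, pi / p[)
    (\sum_(i < size (Q n)) (Q n)`_i * arc_form p (i%:R * t) 0 x) @[n --> \oo] -->
    arc_integral p (j%:R * (t / 2)) 0.
  apply: (@dominated_cvg_Rintegral _ _ _ _ _ _ _ (cst K)).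
  - exact: measurable_itv.
  - move=> n; apply: measurable_sum => i; apply: measurable_funM => //.
    exact: measurable_arc_form.
  - move=> x; rewrite /= in_itv/= => xa.
    under eq_fun do rewrite (QE _ _ xa).
    rewrite -arc_lin_v_pow -v_powX.
    have [C C0 hC] := @normc_exprB R j.
    apply/subr_cvg0.
    apply: (@squeeze_cvg0 _ _ _ _ _ (fun n => ((p + dln_w_bound p) * C * 2) * harmonic n)).
      near=> n.
      have -> : arc_lin x ((1 - visser (v_pow t x) n) ^+ j) - arc_lin x (v_pow (t / 2) x ^+ j)
        = arc_lin x ((1 - visser (v_pow t x) n) ^+ j - v_pow (t / 2) x ^+ j).
        by rewrite arc_linD; congr (_ + _); rewrite /arc_lin; case: (_ ^+ j) => a b /=; ring.
      rewrite (le_trans (normr_arc_lin _ xa))// -!mulrA ler_wpM2l//.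
      rewrite (le_trans (hC _ _ (vn n x xa) (wn x xa)))// ler_wpM2l//.
      have -> : 1 - visser (v_pow t x) n - v_pow (t / 2) x =
        1 - v_pow (t / 2) x - visser (v_pow t x) n by ring.
      have ww : v_pow (t / 2) x ^+ 2 = v_pow t x by rewrite v_powX mulrC divfK.
      rewrite (le_trans (visser_error n ww (cnorm_1Bv_pow (ht x xa))
         (cnorm_1Bv_pow (v_pow_half_disk xa t01 (ht x xa)))))//.
      rewrite (le_trans (visser1_ge n))// ler_wpM2l// /harmonic/= lef_pV2 ?posrE//.
      by rewrite ler_nat.
    rewrite -[X in _ --> X](mulr0 ((p + dln_w_bound p) * C * 2)).
    by apply: cvgMr; exact: cvg_harmonic.
  - apply: (@integrable_itvoo _ _ _ `|K|) => //; by rewrite divr_gt0 ?pi_gt0.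
  - move=> n x; rewrite /= in_itv/= => xa; rewrite (QE _ _ xa).
    rewrite (le_trans (normr_arc_lin _ xa))// ler_wpM2l//.
    elim: (j) => [|k IHk]; first by rewrite !expr0 Normc.normc1.
    by rewrite !exprS Normc.normcM ler_pM ?cnorm_ge0// vn.
rewrite -(cvg_lim _ cv)//; under eq_fun do rewrite In.
by apply/cvg_lim => //; exact: cvg_cst.
Unshelve. all: by end_near.
Qed.

Lemma arc_integral_dyadic m j : arc_integral p (j%:R * 2^-1 ^+ m) 0 = pi.
Proof.
(* The disk condition travels along the induction, since halving the exponent requires it. *)
suff [_ _ h] : [/\ 0 <= (2^-1 : R) ^+ m <= 1,
    forall x, arc x -> expR (2^-1 ^+ m * ln_v p x) <= 2 * cos (2^-1 ^+ m * x) &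
    forall j, arc_integral p (j%:R * 2^-1 ^+ m) 0 = pi] by exact: h.
elim: m => [|m [t01 ht It]].
  rewrite expr0; split; first by rewrite ler01 lexx.
  - by move=> x xa; rewrite !mul1r expR_ln_v_le.
  - by move=> k; rewrite mulr1 arc_integral_nat.
rewrite exprSr; have /andP[t0 t1] := t01; split.
- by rewrite mulr_ge0//= mulr_ile1// invf_le1 ?ler1n.
- by move=> x xa; apply: v_pow_half_disk => //; exact: ht.
- exact: arc_integral_half.
Qed.

Lemma cvg_arc_form (u : nat -> R) t x : u n @[n --> \oo] --> t ->
  arc_form p (u n) 0 x @[n --> \oo] --> arc_form p t 0 x.
Proof.
move=> ut; rewrite /arc_form; have uc c : (u n - p * 0) * c @[n --> \oo] --> (t - p * 0) * c.
  by apply: cvgMl; apply: cvgB => //; exact: cvg_cst.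
apply: cvgM.
  apply: continuous_cvg; first exact: continuous_expR.
  by apply: cvgB; [apply: cvgMl|exact: cvg_cst].
apply: cvgD; apply: cvgMr.
  by apply: continuous_cvg; [exact: continuous_cos|exact: uc].
by apply: continuous_cvg; [exact: continuous_sin|exact: uc].
Qed.

(** Dyadic exponents [u m] approach [t] from below, so the bound for the exponent [t] dominates all
    approximants. *)
Lemma arc_integral_power t : 0 <= t -> arc_integral p t 0 = pi.
Proof.
move=> t0.
pose u m : R := (Num.truncn (t * 2 ^+ m))%:R * 2^-1 ^+ m.
have um m : 0 <= t - u m <= 2^-1 ^+ m.
  have t20 : 0 <= t * 2 ^+ m by rewrite mulr_ge0 ?exprn_ge0.
  have e0 : 0 < (2 : R) ^+ m by rewrite exprn_gt0.
  have /andP[h1 h2] := truncn_itv t20.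
  rewrite /u exprVn subr_ge0 ler_pdivrMr// h1/= lerBlDr.
  rewrite -[X in X + _]mul1r -mulrDl ler_pdivlMr//.
  by rewrite addrC natr1 ltW.
have ucv : u m @[m --> \oo] --> t.
  rewrite -[X in _ --> X]subr0.
  have -> : u = (fun m => t - (t - u m)) by apply/funext => m; rewrite opprB addrC subrK.
  apply: cvgB; first exact: cvg_cst.
  apply: (@squeeze_cvgr _ _ _ _ (cst 0) (fun m => 2^-1 ^+ m)).
  - by apply: nearW => m; exact: um.
  - exact: cvg_cst.
  - by apply: cvg_expr; rewrite gtr0_norm ?invr_gt0// invf_lt1// ltr1n.
pose K := arc_bound p t 0 * (p + dln_w_bound p).
have cv : arc_integral p (u m) 0 @[m --> \oo] --> arc_integral p t 0.
  apply: (@dominated_cvg_Rintegral _ _ _ _ _ _ _ (cst K)).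
  - exact: measurable_itv.
  - by move=> m; exact: measurable_arc_form.
  - by move=> x _; exact: cvg_arc_form.
  - by apply: (@integrable_itvoo _ _ _ `|K|) => //; rewrite divr_gt0 ?pi_gt0.
  - move=> m x; rewrite /= in_itv/= => xa.
    have u0 : 0 <= u m by rewrite mulr_ge0// exprn_ge0.
    rewrite (le_trans (arc_form_bounded p2 0 xa u0))// /K ler_wpM2r//.
      have := dln_w_bounds p2 xa; rewrite /dln_w_bound; have := p0; lra.
    rewrite ler_expR lerD2r ler_wpM2r//; first by rewrite ln_ge0// ler1n.
    by have := um m; lra.
rewrite -(cvg_lim _ cv)//.
rewrite (_ : (fun m => arc_integral p (u m) 0) = cst pi).
  by apply/cvg_lim => //; exact: cvg_cst.
by apply/funext => m; exact: arc_integral_dyadic.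
Qed.

(** The recursion, applied [k] times, lowers [(t + k, k)] to [(t, 0)]. The product over the
    factorial is the binomial coefficient [C(t + k, k)]. *)
Lemma arc_integral_binomial k t : 1 <= t ->
  arc_integral p (t + k%:R) k%:R = pi * \prod_(0 <= i < k) (t + k%:R - i%:R) / k`!%:R.
Proof.
move=> t1; elim: k => [|k IH].
  by rewrite big_geq// fact0 addr0 arc_integral_power ?mulr1 ?divr1// (le_trans ler01).
have h := @arc_integral_rec R p p2 (t + k.+1%:R) k.+1%:R.
have kk : k.+1%:R != 0 :> R by rewrite pnatr_eq0.
have t1' : 1 <= t + k.+1%:R by rewrite ler_wpDr.
have := h t1'.
have -> : t + k.+1%:R - 1 = t + k%:R by rewrite -natr1; ring.
have -> : k.+1%:R - 1 = k%:R :> R by rewrite -natr1 addrK.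
rewrite IH => /(canRL (mulKf kk)) ->.
rewrite big_nat_recl// subr0 factS natrM.
have -> : \prod_(0 <= i < k) (t + k.+1%:R - i.+1%:R) = \prod_(0 <= i < k) (t + k%:R - i%:R).
  by apply: eq_bigr => i _; rewrite -!natr1; ring.
have fk : k`!%:R != 0 :> R by rewrite pnatr_eq0 -lt0n fact_gt0.
move: kk; move: (k.+1%:R : R) => c kk.
by field; rewrite fk kk.
Qed.

End real_exponents.

(** * Mixtures of inverse square root densities *)

Section root_mixture.
Context {R : realType}.
Local Notation mu := (@lebesgue_measure R).
Local Notation mR := (measurableTypeR R).
Implicit Types (c x y : R) (k : nat).

Lemma cvg_sqrtX (y : R) k : Num.sqrt x ^+ k @[x --> y] --> Num.sqrt y ^+ k.
Proof.
elim: k => [|k IH]; first by under eq_fun do rewrite expr0; exact: cvg_cst.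
under eq_fun do rewrite exprS.
by rewrite exprS; apply: cvgM => //; exact: sqrt_continuous.
Qed.

(** The primitive is a multiple of an odd power of the square root; its exponent [2 k + 1] is the
    source of the division by [n] in the moments. *)
Lemma integral_root_power c k : 0 <= c ->
  (\int[mu]_(y in `]0%R, c[) (y ^+ k / Num.sqrt y)%:E =
   (2 / k.*2.+1%:R * Num.sqrt c ^+ k.*2.+1)%:E)%E.
Proof.
rewrite le_eqVlt => /predU1P[<-|c0].
  by rewrite set_itvoo0 integral_set0 sqrtr0 expr0n/= mulr0.
have k0 : k.*2.+1%:R != 0 :> R by rewrite pnatr_eq0.
rewrite -[X in X%:E]subr0.
apply: (@ge0_integral_itvoo_derive _ 0 c 0 _ (fun y => y ^+ k / Num.sqrt y)
  (fun y => 2 / k.*2.+1%:R * Num.sqrt y ^+ k.*2.+1) c0).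
- move=> y /andP[y0 _].
  have d := is_derive1_sqrt y0.
  have dX : is_derive y 1 (fun y : R => Num.sqrt y ^+ k.*2.+1)
      (k.*2.+1%:R * Num.sqrt y ^+ k.*2 * (2 * Num.sqrt y)^-1).
    rewrite (_ : (fun y => _) = (@Num.sqrt R : R -> R) ^+ k.*2.+1); last first.
      by apply/funext => z; rewrite fctE.
    by apply: (is_derive_eq (@is_deriveX R R (@Num.sqrt R : R -> R) k.*2.+1 y 1 _ d)).
  have s0 : Num.sqrt y != 0 by rewrite gt_eqF// sqrtr_gt0.
  apply: is_derive_eq.
  have -> : y ^+ k = Num.sqrt y ^+ k.*2 by rewrite -mul2n exprM sqr_sqrtr// ltW.
  rewrite /GRing.scale/=.
  move: k0; move: (k.*2.+1%:R : R) => e e0.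
  by field; rewrite ?e0 ?s0.
- move=> y /andP[y0 _]; apply: cvgM.
    by apply: exprn_continuous.
  by apply: cvgV; [rewrite gt_eqF// sqrtr_gt0|exact: sqrt_continuous].
- apply: cvg_at_right_filter.
  rewrite -[X in _ --> X](mulr0 (2 / k.*2.+1%:R)); apply: cvgMr.
  by have := @cvg_sqrtX 0 k.*2.+1; rewrite sqrtr0 expr0n.
- by apply: cvg_at_left_filter; apply: cvgMr; exact: cvg_sqrtX.
- by move=> y /andP[y0 _]; rewrite divr_ge0 ?sqrtr_ge0// exprn_ge0// ltW.
Qed.

Variables (P U : mR -> R) (M : R).
Hypotheses (mP : measurable_fun setT P) (PM : forall x, 0 <= P x <= M).
Hypotheses (U0 : forall x, 0 <= U x) (iU : mu.-integrable setT (EFin \o U)).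

Let mU : measurable_fun setT U.
Proof. by case/integrableP : iU => /measurable_EFinP. Qed.

(* At [y <= 0] the junk values [Num.sqrt y = 0] and [0^-1 = 0] give the intended
   value [0]. *)
Definition root_mixture (y : mR) : R :=
  (Num.sqrt y)^-1 * \int[mu]_x (if y < P x then U x else 0).

Lemma measurable_root_section y : measurable_fun setT (fun x => if y < P x then U x else 0).
Proof.
by apply: measurable_fun_ifT => //; apply: measurable_fun_ltr => //; exact: measurable_cst.
Qed.

Lemma integrable_root_section y :
  mu.-integrable setT (EFin \o (fun x => if y < P x then U x else 0)).
Proof.
apply: (le_integrable _ _ _ iU) => //.
  by apply/measurable_EFinP; exact: measurable_root_section.
by move=> x _ /=; rewrite lee_fin; case: ifP; rewrite ?normr0.
Qed.

Lemma root_mixture_ge0 y : 0 <= root_mixture y.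
Proof.
rewrite mulr_ge0 ?invr_ge0 ?sqrtr_ge0//; apply: Rintegral_ge0 => x _.
by case: ifP.
Qed.

Lemma root_mixture_supp y : ~~ (0 < y < M) -> root_mixture y = 0.
Proof.
rewrite negb_and -!leNgt => /orP[y0|My].
  by rewrite /root_mixture ler0_sqrtr// invr0 mul0r.
rewrite /root_mixture (@eq_Rintegral _ _ _ _ _ (cst 0)).
  by rewrite Rintegral_cst// mul0r mulr0.
by move=> x _; case: ltP => // /(le_lt_trans My); have /andP[_ h] := PM x; rewrite ltNge h.
Qed.

(** Both factors are nonnegative and nonincreasing: the set where [y < P x] shrinks as [y] grows. *)
Lemma root_mixture_nonincreasing :
  {in `]0, +oo[ &, {homo root_mixture : x y / x <= y >-> y <= x}}.
Proof.
move=> x y; rewrite !in_itv/= !andbT => x0 y0 xy.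
apply: ler_pM.
- by rewrite invr_ge0 sqrtr_ge0.
- by apply: Rintegral_ge0 => z _; case: ifP.
- by rewrite lef_pV2 ?posrE ?sqrtr_gt0// ler_wsqrtr.
- apply: le_Rintegral => //; try exact: integrable_root_section.
  by move=> z _; case: ifP => [/(le_lt_trans xy) ->//|_]; case: ifP.
Qed.

(** The integrand for Tonelli's theorem: the first coordinate is the variable of the density, the
    second the mixing variable. *)
Let kernel k (z : mR * mR) : \bar R :=
  (z.1 ^+ k / Num.sqrt z.1 * (if z.1 < P z.2 then U z.2 else 0))%:E.

Let kernel_ge0 k z : (0 <= kernel k z)%E.
Proof.
rewrite lee_fin mulr_ge0//; last by case: ifP.
have [z0|/ltW z0] := leP z.1 0; first by rewrite ler0_sqrtr// invr0 mulr0.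
by rewrite divr_ge0 ?sqrtr_ge0// exprn_ge0.
Qed.

Lemma measurable_root_power k : measurable_fun setT (fun y : mR => y ^+ k / Num.sqrt y).
Proof.
(* For [y <= 0] the square root and its inverse are [0], which leaves the open half-line, where the
   function is continuous. *)
have -> : (fun y : mR => y ^+ k / Num.sqrt y) =
    (fun y : mR => y ^+ k / Num.sqrt y) \_ `]0%R, +oo[.
  apply/funext => y; rewrite patchE mem_setE in_itv/= andbT.
  by case: ltP => // y0; rewrite ler0_sqrtr// invr0 mulr0.
apply: (measurable_restrictT _ (measurable_itv _)).1.
apply: open_continuous_measurable_fun; first by rewrite set_itvE; exact: open_gt.
move=> y; rewrite inE/= in_itv/= andbT => y0; apply: cvgM; first exact: exprn_continuous.
by apply: cvgV; [rewrite gt_eqF// sqrtr_gt0|exact: sqrt_continuous].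
Qed.

Let measurable_kernel k : measurable_fun setT (kernel k).
Proof.
apply/measurable_EFinP; apply: measurable_funM.
  exact: (measurableT_comp (measurable_root_power k) measurable_fst).
apply: measurable_fun_ifT.
- apply: measurable_fun_ltr; first exact: measurable_fst.
  exact: (measurableT_comp mP measurable_snd).
- exact: (measurableT_comp mU measurable_snd).
- exact: measurable_cst.
Qed.

Let kernel_sum k y : (\int[mu]_x kernel k (y, x) = (y ^+ k * root_mixture y)%:E)%E.
Proof.
rewrite /kernel/= /root_mixture mulrA EFinM.
rewrite -[X in (_ * X)%E](_ : \int[mu]_x (if y < P x then U x else 0)%:E = _)%E; last first.
  by rewrite /Rintegral fineK//; apply: integrable_fin_num => //; exact: integrable_root_section.
under eq_integral do rewrite EFinM.
rewrite ge0_integralZl//.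
- by apply/measurable_EFinP; exact: measurable_root_section.
- by move=> x _; rewrite lee_fin; case: ifP.
- rewrite lee_fin; have [z0|/ltW z0] := leP y 0; first by rewrite ler0_sqrtr// invr0 mulr0.
  by rewrite divr_ge0 ?sqrtr_ge0// exprn_ge0.
Qed.

Lemma measurable_root_mixture : measurable_fun setT root_mixture.
Proof.
apply/measurable_EFinP.
have := measurable_fun_fubini_tonelli_F (m2 := mu) (kernel 0) (measurable_kernel 0) (kernel_ge0 0).
rewrite (_ : fubini_F _ _ = EFin \o root_mixture)//.
by apply/funext => y; rewrite /fubini_F kernel_sum expr0 mul1r.
Qed.

(** After Tonelli the inner integral runs over [0 < y < P x], where [integral_root_power] evaluates
    it. *)
Lemma integral_root_mixture k :
  (\int[mu]_y (y ^+ k * root_mixture y)%:E =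
   \int[mu]_x (2 / k.*2.+1%:R * Num.sqrt (P x) ^+ k.*2.+1 * U x)%:E)%E.
Proof.
under eq_integral do rewrite -kernel_sum.
rewrite (@fubini_tonelli _ _ mR mR R mu mu (kernel k))//.
apply: eq_integral => x _; have /andP[P0 _] := PM x.
rewrite EFinM -(integral_root_power k P0) muleC -ge0_integralZl//; first last.
- by rewrite lee_fin.
- move=> y; rewrite /= in_itv/= => /andP[y0 _].
  by rewrite lee_fin divr_ge0 ?sqrtr_ge0// exprn_ge0// ltW.
- by apply/measurable_EFinP; apply: measurable_funTS; exact: measurable_root_power.
rewrite [RHS]integral_mkcond; apply: eq_integral => y _.
rewrite patchE mem_setE in_itv/= /kernel/=.
have [y0|y0] := leP y 0; first by rewrite ler0_sqrtr// invr0 mulr0 mul0r.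
by case: ifP => _; rewrite ?mulr0// mulrC EFinM.
Qed.

End root_mixture.

(** * The density of mu(2r, r) *)

Section fuss_catalan_density.
Context {R : realType}.
Variable r : R.
Hypothesis r1 : 1 <= r.
Implicit Types (x : R) (k : nat).
Local Notation mu := (@lebesgue_measure R).
Local Notation mR := (measurableTypeR R).
Local Notation p := (2 * r).
Local Notation arc x := (0 < x < pi / p).
Local Notation D := (`]0, pi / p[%classic : set mR).

Let p2 : 2 <= p. Proof. by rewrite ler_pMr. Qed.
Let r0 : 0 < r. Proof. exact: lt_le_trans r1. Qed.

(* [(1 + w) ^ p / w], extended by [0] outside of the arc. *)
Definition fc_rho : mR -> R := (fun x => expR (p * ln_v p x - 1 * ln_w p x)) \_ D.

(** What remains of [arc_form] at [al = (2 k + 1) r], [ka = k] once [fc_rho ^ (k + 1 / 2)] is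
    factored out. It is independent of [k] because [al - p * ka = r]. *)
Definition fc_weight : mR -> R := (fun x => expR (ln_w p x / 2) *
  (p * cos (r * x) + dln_w p x * sin (r * x))) \_ D.

(** The normalization cancels the [pi] of [arc_integral_binomial] and the [2] of
    [integral_root_power]. *)
Definition fc_density y : R := (2 * pi)^-1 * root_mixture fc_rho fc_weight y.

Lemma fc_rho_bounds x : 0 <= fc_rho x <= arc_bound p p 1.
Proof.
rewrite /fc_rho patchE mem_setE in_itv/=; case: ifPn => xa; last by rewrite lexx expR_ge0.
by rewrite expR_ge0 arc_expR_le// ltW// (lt_le_trans _ p2).
Qed.

Lemma measurable_fc_rho : measurable_fun setT fc_rho.
Proof.
apply: (measurable_restrictT _ (measurable_itv _)).1.
apply: open_continuous_measurable_fun; first exact: interval_open.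
move=> x; rewrite inE/= in_itv/= => xa.
apply: continuous_comp; last exact: continuous_expR.
by apply: cvgB; apply: cvgMr; [exact: continuous_ln_v|exact: continuous_ln_w].
Qed.

(** As [p = 2 r], the angle [r * x] stays below [pi / 2] on the arc, so its sine and cosine are
    nonnegative, and so is [dln_w]. *)
Lemma fc_weight_bounds x : arc x ->
  0 <= p * cos (r * x) + dln_w p x * sin (r * x) <= p + dln_w_bound p.
Proof.
move=> xa; have [x0 xp xpi qx] := arc_bounds p2 xa.
have /andP[d0 dK] := dln_w_bounds p2 xa.
have rx : 0 < r * x < pi / 2.
  by rewrite mulr_gt0//= ltr_pdivlMr// mulrC mulrA.
have pi0 := @pi_gt0 R.
have c0 : 0 <= cos (r * x) by apply: cos_ge0_pihalf; lra.
have s0 : 0 <= sin (r * x) by apply: sin_ge0_pi; lra.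
have pp : 0 <= p by rewrite (le_trans _ p2).
apply/andP; split; first by apply: addr_ge0; apply: mulr_ge0.
apply: lerD; first by rewrite ler_piMr// cos_le1.
by apply: le_trans dK; rewrite ler_piMr// sin_le1.
Qed.

Lemma fc_weight_ge0 x : 0 <= fc_weight x.
Proof.
rewrite /fc_weight patchE mem_setE in_itv/=; case: ifPn => // xa.
by rewrite mulr_ge0 ?expR_ge0//; case/andP: (fc_weight_bounds xa).
Qed.

Lemma integrable_fc_weight : mu.-integrable setT (EFin \o fc_weight).
Proof.
pose g x := expR (ln_w p x / 2) * (p * cos (r * x) + dln_w p x * sin (r * x)).
suff h : mu.-integrable D (EFin \o g).
  have mD : measurable D by exact: measurable_itv.
  by have := (integrable_mkcond _ mD).1 h; rewrite restrict_EFin.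
apply: (@integrable_itvoo _ _ _ (p + dln_w_bound p)).
- by rewrite divr_gt0 ?pi_gt0 ?mulr_gt0.
- apply: open_continuous_measurable_fun; first exact: interval_open.
  move=> x; rewrite inE/= in_itv/= => xa; apply: cvgM.
    apply: continuous_comp; last exact: continuous_expR.
    by apply: cvgMl; exact: continuous_ln_w.
  apply: cvgD; first by apply: cvgMr; exact: cvg_cosZ.
  by apply: cvgM; [exact: continuous_dln_w|exact: cvg_sinZ].
- move=> x xa; have /andP[w0 wK] := fc_weight_bounds xa.
  rewrite ger0_norm ?mulr_ge0 ?expR_ge0//.
  apply: le_trans wK; rewrite ler_piMl// -[leRHS]expR0 ler_expR.
  by rewrite ler_pdivrMr// mul0r (ln_w_le0 p2).
Qed.

Lemma fc_power k x : arc x ->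
  Num.sqrt (fc_rho x) ^+ k.*2.+1 * fc_weight x = arc_form p (k.*2.+1%:R * r) k%:R x.
Proof.
move=> xa; rewrite /fc_rho /fc_weight !patchE !mem_setE !in_itv/= xa /arc_form.
set z := p * ln_v p x - 1 * ln_w p x.
have -> : Num.sqrt (expR z) = expR (z / 2).
  have {1}-> : z = z / 2 + z / 2 by field.
  by rewrite expRD -expr2 sqrtr_sqr ger0_norm ?expR_ge0.
rewrite -expRM_natl [LHS]mulrA -expRD -muln2 -addn1 natrD natrM.
congr (expR _ * (_ * cos _ + _ * sin _)); rewrite /z; by field.
Qed.

Lemma fc_moment k :
  (\int[mu]_y (y ^+ k * fc_density y)%:E = (fuss_catalan_number p r k)%:E)%E.
Proof.
have pi0 := @pi_gt0 R.
have c0 : 0 <= (2 * pi)^-1 :> R by rewrite invr_ge0 mulr_ge0// ltW.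
have k0 : k.*2.+1%:R != 0 :> R by rewrite pnatr_eq0.
have al0 : 0 <= k.*2.+1%:R * r by rewrite mulr_ge0// ltW.
have ia := integrable_arc_form p2 k%:R al0.
have mf := measurable_root_mixture measurable_fc_rho fc_weight_ge0 integrable_fc_weight.
have f0 := root_mixture_ge0 fc_rho fc_weight_ge0.
have supp y : ~~ (0 < y) -> root_mixture fc_rho fc_weight y = 0.
  move=> y0; apply: (root_mixture_supp _ fc_rho_bounds).
  by rewrite negb_and y0.
transitivity ((2 * pi)^-1%:E * \int[mu]_y (y ^+ k * root_mixture fc_rho fc_weight y)%:E)%E.
  rewrite -ge0_integralZl//; last first.
  - move=> y _; rewrite lee_fin; have [y0|y0] := leP y 0.
      by rewrite supp ?mulr0// -leNgt.
    by rewrite mulr_ge0// exprn_ge0// ltW.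
  - by apply/measurable_EFinP; apply: measurable_funM.
  by apply: eq_integral => y _; rewrite -EFinM /fc_density mulrCA.
rewrite (integral_root_mixture measurable_fc_rho fc_rho_bounds fc_weight_ge0 integrable_fc_weight).
transitivity ((2 * pi)^-1%:E * (\int[mu]_(x in D) (2 / k.*2.+1%:R * arc_form p (k.*2.+1%:R * r) k%:R x)%:E))%E.
  congr (_ * _)%E; rewrite [RHS]integral_mkcond; apply: eq_integral => x _.
  rewrite patchE mem_setE in_itv/=; case: ifPn => xa.
    by rewrite -mulrA fc_power.
  by rewrite /fc_weight patchE mem_setE in_itv/= (negbTE xa) mulr0.
under eq_integral do rewrite EFinM.
rewrite integralZl//.
have -> : (\int[mu]_(x in D) (arc_form p (k.*2.+1%:R * r) k%:R x)%:E =
    (arc_integral p (k.*2.+1%:R * r) k%:R)%:E)%E.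
  by rewrite /arc_integral /Rintegral fineK//; apply: integrable_fin_num.
rewrite -!EFinM; congr EFin.
(* The binomial formula is used with [t = (2 k + 1) r - k], which is at least [k + 1] since
   [r >= 1]. *)
have tE : k.*2.+1%:R * r = (k.*2.+1%:R * r - k%:R) + k%:R by ring.
have t1 : 1 <= k.*2.+1%:R * r - k%:R.
  rewrite -muln2 -addn1 natrD natrM.
  have r10 : 0 <= r - 1 by rewrite subr_ge0.
  rewrite -subr_ge0.
  have -> : (k%:R * 2%:R + 1%:R) * r - k%:R - 1 = k%:R * (2 * (r - 1)) + k%:R + (r - 1) by ring.
  by apply: addr_ge0 => //; apply: addr_ge0 => //; rewrite !mulr_ge0.
rewrite tE (arc_integral_binomial p2 k t1) -tE.
have fk : k`!%:R != 0 :> R by rewrite pnatr_eq0 -lt0n fact_gt0.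
have pin : pi != 0 :> R by rewrite gt_eqF.
clear -k0 fk pin r1; move: pin; generalize (@pi R) => w w0.
case: k k0 fk => [|k] k0 fk.
  rewrite (_ : fuss_catalan_number _ _ 0 = 1)// big_geq// fact0 double0.
  by field; rewrite ?w0.
(* The factor of index [0] is [n * r], with [n] the odd number by which the moment is divided; the
   quotient is the leading [r] of the Fuss-Catalan number. *)
rewrite /fuss_catalan_number big_ltn// subr0.
have -> : \prod_(1 <= i < k.+1) (k.+1.*2.+1%:R * r - i%:R) =
    \prod_(1 <= i < k.+1) (k.+1%:R * (2 * r) + r - i%:R).
  apply: eq_bigr => i _; congr (_ - _).
  by rewrite -muln2 -[X in X%:R * r]addn1 natrD natrM; ring.
move: k0 fk; move: (k.+1.*2.+1%:R : R) (k.+1`!%:R : R) => e d e0 d0.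
by field; rewrite ?e0 ?d0 ?w0.
Qed.

End fuss_catalan_density.

(** * Identification of the given measure with the constructed density *)

Theorem proposition4p6 (R : realType) (r : R) (hr : 1 <= r)
    (mu : probability (measurableTypeR R) R)
    (hmu : is_fuss_catalan (2 * r) r mu) :
  unimodal mu.
Proof.
have [[K cK muK] moments] := hmu.
have pi0 := @pi_gt0 R.
have c0 : 0 <= (2 * pi)^-1 :> R by rewrite invr_ge0 mulr_ge0// ltW.
have r0 : 0 < r by exact: lt_le_trans hr.
have f0 y : 0 <= fc_density r y.
  by rewrite mulr_ge0//; apply: root_mixture_ge0 => x; exact: fc_weight_ge0.
have mf : measurable_fun setT (fc_density r).
  apply: measurable_funM => //.
  exact: (measurable_root_mixture (measurable_fc_rho hr) (fc_weight_ge0 hr) (integrable_fc_weight hr)).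
have [B KB] : exists B, forall x, K x -> `|x| <= B.
  have [B [_ h]] := compact_bounded cK.
  by exists (B + 1) => x Kx; apply: h => //; rewrite ltrDl.
(* Both [K] and the points where the density is nonzero lie in the open interval []- M, M[]. *)
pose M := `|B| + arc_bound (2 * r) (2 * r) 1 + 1.
have bM0 : 0 < arc_bound (2 * r) (2 * r) 1 by exact: expR_gt0.
have M0 : 0 < M by rewrite /M; have := normr_ge0 B; lra.
have suppf y : ~~ (0 < y < arc_bound (2 * r) (2 * r) 1) -> fc_density r y = 0.
  by move=> h; rewrite /fc_density (root_mixture_supp _ (fc_rho_bounds hr)) ?mulr0.
(* The measure [mu] enters through a density with respect to itself: [g1] is [1] almost everywhere,
   because [mu] does not charge the complement of [K]. *)
pose g1 : measurableTypeR R -> R := \1_(`]- M, M[%classic).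
have mK : measurable (K : set (measurableTypeR R)) by exact: compact_measurable.
have ae1 : ae_eq mu setT (fun=> 1) g1.
  exists (~` K); split => //; first exact: measurableC.
  move=> x /= h; apply: contra_not h => Kx _; rewrite /g1 indicE mem_setE in_itv/=.
  have := KB _ Kx; have := ler_norm B; rewrite ler_norml => h1 /andP[h2 h3].
  have -> : - M < x < M by rewrite /M; lra.
  by [].
have mg1 : measurable_fun setT g1 by exact: measurable_indic.
have intf : lebesgue_measure.-integrable setT (EFin \o fc_density r).
  apply/integrableP; split; first exact/measurable_EFinP.
  have := fc_moment hr 0; under eq_integral do rewrite expr0 mul1r.
  move=> h; rewrite (eq_integral (fun y => (fc_density r y)%:E)).
    by rewrite h ltry.
  by move=> y _; rewrite /= ger0_norm.
(* The mode is [0], without an atom; left of it the density is [0]. *)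
exists 0, 0, (fc_density r); split => //.
- move=> x y _; rewrite in_itv/= => y0 xy.
  by rewrite suppf// negb_and -leNgt (ltW (le_lt_trans xy y0)).
- move=> x y x0 y0 xy; rewrite ler_wpM2l//.
  exact: (root_mixture_nonincreasing (measurable_fc_rho hr) (fc_weight_ge0 hr) (integrable_fc_weight hr)).
move=> A mA; rewrite mul0e add0e.
rewrite -(@eq_density_moments _ mu lebesgue_measure g1 (fc_density r) M) //.
- transitivity (\int[mu]_(x in A) (cst 1 x))%E; first by rewrite integral_cst// mul1e.
  apply: ae_eq_integral => //.
  + by apply/measurable_EFinP; apply: measurable_funTS.
  + apply: filterS ae1 => x h _; rewrite /= -h//.
- by move=> x h; rewrite /g1 indicE mem_setE in_itv/= (negbTE h).
- move=> x h; apply: suppf; apply: contra h => /andP[x0 xM].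
  by rewrite /M; have := normr_ge0 B; lra.
- apply: measurable_bounded_integrable => //.
    by rewrite (le_lt_trans (probability_le1 mu _))// ltry.
  exists 1; split => // t t1 x _ /=; rewrite /g1 indicE.
  by rewrite ger0_norm// (le_trans _ (ltW t1))// lern1 leq_b1.
- move=> k; rewrite /Rintegral; congr fine.
  rewrite (fc_moment hr) -moments; apply/esym.
  apply: ae_eq_integral => //.
  + by apply/measurable_EFinP.
  + by apply/measurable_EFinP; apply: measurable_funM.
  + apply: filterS ae1 => x h _; rewrite /= -h// mulr1//.
Qed.
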